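(* Let $p,q\ge2$ be integers, suppose $(\beta,h)\in\Theta$ is type-II special, and let $\boldsymbol m_*=\boldsymbol x_s$ denote the unique maximizer of $H_{\beta,h}$. Define $\boldsymbol u:=(1-q,1,\dots,1)\in\mathbb R^q$. Let $\bar\beta,\bar h\in\mathbb R$ and $\boldsymbol X\sim\mathbb P_{\beta+N^{-5/6}\bar\beta,\,h+N^{-5/6}\bar h,\,N}$. Then, as $N\to\infty$, $$N^{1/6}\left(\bar{\boldsymbol X}_N-\boldsymbol m_*\right)\xrightarrow{D}F_{\bar h}\,\boldsymbol u,$$ where the real random variable $F_{\bar h}$ has density with respect to Lebesgue measure proportional to $$\exp\left(-\frac{32}{15}x^6-\bar hx\right).$$
   Context: For real $\beta,h$ and $N\ge1$, $\mathbb P_{\beta,h,N}$ is the probability measure on $\{1,\dots,q\}^N$ with $\mathbb P_{\beta,h,N}(\boldsymbol X)\propto\exp\left(\beta N\sum_{r=1}^q\bar X_{\cdot r}^p+Nh\bar X_{\cdot1}\right)$, where $\bar X_{\cdot r}=N^{-1}\#\{i:X_i=r\}$; $\bar{\boldsymbol X}_N=(\bar X_{\cdot1},\dots,\bar X_{\cdot q})^\top$. $\Theta=(0,\infty)\times[0,\infty)$. On the set $\mathcal P_q$ of probability vectors in $\mathbb R^q$, $H_{\beta,h}(\boldsymbol t)=\beta\sum_r t_r^p+ht_1-\sum_r t_r\log t_r$. For $s\in[0,1]$, $\boldsymbol x_s=\left(\frac{1+(q-1)s}{q},\frac{1-s}{q},\dots,\frac{1-s}{q}\right)$ and $f_{\beta,h}(s)=H_{\beta,h}(\boldsymbol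 x_s)$. A unique global maximizer of $H_{\beta,h}$ is of the form $\boldsymbol x_s$, $s\in[0,1)$. With $\boldsymbol Q_{\boldsymbol v,\beta}(\boldsymbol t)=\sum_{r=1}^q\left(\beta p(p-1)v_r^{p-2}-\frac1{v_r}\right)t_r^2$ and $\mathcal H_q=\{\boldsymbol t\in\mathbb R^q:\sum_r t_r=0\}$, the point $(\beta,h)$ is special if $H_{\beta,h}$ has a unique global maximizer $\boldsymbol m_*=\boldsymbol x_s$ and $\boldsymbol Q_{\boldsymbol m_*,\beta}$ is singular on $\mathcal H_q$ (there is a nonzero $\boldsymbol t\in\mathcal H_q$ with $\boldsymbol Q_{\boldsymbol m_*,\beta}(\boldsymbol t)=0$); it is type-II special if moreover $f^{(4)}_{\beta,h}(s)=0$. *)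

(* Defs.v *)
From HB Require Import structures.
From mathcomp Require Import all_boot all_order all_algebra.
From mathcomp Require Import all_classical all_reals all_analysis.

Set Implicit Arguments.
Unset Strict Implicit.
Unset Printing Implicit Defensive.
Import Order.TTheory GRing.Theory Num.Theory.
Import numFieldTopology.Exports numFieldNormedType.Exports.

Local Open Scope classical_set_scope.
Local Open Scope ring_scope.

(* The colours {1, ..., q} are the ordinals 'I_q; colour 1 is the ordinal 0. *)
Definition color1 (q : nat) (hq : (1 < q)%N) : 'I_q := Ordinal (ltnW hq).

(* An alias, carrying [hq], so that the configuration space can be pointed
   (as [measurableType] requires) and given the discrete sigma-algebra. *)
Definition config (q : nat) (hq : (1 < q)%N) (N : nat) : Type :=
  {ffun 'I_N -> 'I_q}.

HB.instance Definition _ q hq N :=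
  Finite.copy (@config q hq N) {ffun 'I_N -> 'I_q}.
HB.instance Definition _ q hq N :=
  isPointed.Build (@config q hq N) [ffun=> color1 hq].
HB.instance Definition _ q hq N :=
  @isMeasurable.Build default_measure_display (@config q hq N)
    discrete_measurable discrete_measurable0
    discrete_measurableC discrete_measurableU.

Section potts.
Context {R : realType} (q : nat) (hq : (1 < q)%N) (p : nat) (beta h : R).

Definition empirical (N : nat) (X : {ffun 'I_N -> 'I_q}) : 'cV[R]_q :=
  \col_r (#|[set i | X i == r]|%:R / N%:R).

Definition potts_weight (N : nat) (X : config hq N) : R :=
  expR (beta * N%:R * (\sum_(r < q) empirical X r 0 ^+ p)
        + N%:R * h * empirical X (color1 hq) 0).

Definition potts_partition (N : nat) : R :=
  \sum_(X : config hq N) potts_weight X.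

Definition potts (N : nat) (A : set (config hq N)) : \bar R :=
  (\esum_(X in A) (potts_weight X / potts_partition N)%:E)%E.

End potts.

Section potts_probability.
Context {R : realType} (q : nat) (hq : (1 < q)%N) (p : nat) (beta h : R)
  (N : nat).
Local Notation w := (@potts_weight R q hq p beta h N).
Local Notation Z := (@potts_partition R q hq p beta h N).
Local Notation mu := (@potts R q hq p beta h N).

Let Z_gt0 : 0 < Z.
Proof.
rewrite /potts_partition (bigD1 (point : config hq N)) //=.
by rewrite ltr_pwDl ?expR_gt0 // sumr_ge0 // => X _; exact: expR_ge0.
Qed.

Let pmf_ge0 X : (0 <= (w X / Z)%:E)%E.
Proof. by rewrite lee_fin divr_ge0 ?expR_ge0 // ltW. Qed.

Let potts0 : mu set0 = 0%E.
Proof. exact: esum_set0. Qed.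

Let potts_ge0 A : (0 <= mu A)%E.
Proof. by apply: esum_ge0 => X _; exact: pmf_ge0. Qed.

Let potts_sigma_additive : semi_sigma_additive mu.
Proof.
move=> F mF tF mUF; rewrite /potts; apply: cvg_toP.
  apply: ereal_nondecreasing_is_cvgn => a b ab.
  by apply: lee_sum_nneg_natr => // k _ _; exact: potts_ge0.
by rewrite nneseries_sum_bigcup.
Qed.

HB.instance Definition _ := isMeasure.Build _ _ _ mu
  potts0 potts_ge0 potts_sigma_additive.

Let potts_setT : mu [set: _] = 1%E.
Proof.
rewrite /potts esum_fset //; last exact: finite_finset.
rewrite -(_ : [set` index_enum (config hq N)] = [set: config hq N]); last first.
  by apply/seteqP; split => x //= _; rewrite mem_index_enum.
rewrite -fsbig_seq ?index_enum_uniq //.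
by rewrite sumEFin -mulr_suml divff // gt_eqF.
Qed.

HB.instance Definition _ :=
  @Measure_isProbability.Build _ _ R mu potts_setT.

End potts_probability.

Section landscape.
Context {R : realType} (q : nat) (hq : (1 < q)%N) (p : nat) (beta h : R).

Definition simplex : set 'cV[R]_q :=
  [set t | (forall r, 0 <= t r 0) /\ \sum_(r < q) t r 0 = 1].

(* [ln 0 = 0], so the convention 0 log 0 = 0 on the boundary is built in. *)
Definition potts_H (t : 'cV[R]_q) : R :=
  beta * (\sum_(r < q) t r 0 ^+ p) + h * t (color1 hq) 0
  - \sum_(r < q) t r 0 * ln (t r 0).

Definition global_maximizer (m : 'cV[R]_q) : Prop :=
  simplex m /\ forall t, simplex t -> potts_H t <= potts_H m.

Definition unique_global_maximizer (m : 'cV[R]_q) : Prop :=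
  global_maximizer m /\ forall m', global_maximizer m' -> m' = m.

Definition potts_x (s : R) : 'cV[R]_q :=
  \col_r (if r == color1 hq then (1 + (q%:R - 1) * s) / q%:R
          else (1 - s) / q%:R).

(* Defined for every real [s].  All coordinates of [potts_x s] are positive for
   -1/(q-1) < s < 1, so [potts_f] is smooth there and its two-sided
   derivatives at s in [0, 1[ agree with those (one-sided at 0) of its
   restriction to [0, 1]. *)
Definition potts_f (s : R) : R := potts_H (potts_x s).

Definition potts_Q (v t : 'cV[R]_q) : R :=
  \sum_(r < q) (beta * (p%:R * (p%:R - 1)) * v r 0 ^+ (p - 2) - (v r 0)^-1)
               * t r 0 ^+ 2.

Definition zero_sum : set 'cV[R]_q := [set t | \sum_(r < q) t r 0 = 0].

Definition singular_at (v : 'cV[R]_q) : Prop :=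
  exists t, [/\ zero_sum t, t != 0 & potts_Q v t = 0].

Definition special_at (s : R) : Prop :=
  [/\ 0 <= s < 1, unique_global_maximizer (potts_x s) & singular_at (potts_x s)].

Definition type2_special : Prop :=
  exists s, special_at s /\ (potts_f^`(4))%classic s = 0.

End landscape.

Definition potts_u (R : realType) (q : nat) (hq : (1 < q)%N) : 'cV[R]_q :=
  \col_r (if r == color1 hq then 1 - q%:R else 1).

(* Weak convergence of the laws of [Y n] to the law of [Z], tested against
   bounded continuous functions; each variable may live on its own probability
   space.  It is meant for Borel measurable [Y n] and [Z]. *)
Definition cvg_in_distribution (R : realType) (V : topologicalType)
    (d : nat -> measure_display) (T : forall n, measurableType (d n))
    (P : forall n, probability (T n) R) (Y : forall n, T n -> V)
    (d' : measure_display) (T' : measurableType d')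
    (P' : probability T' R) (Z : T' -> V) : Prop :=
  forall g : V -> R, continuous g -> (exists M, forall v, `|g v| <= M) ->
    ('E_(P n)[g \o Y n] @[n --> \oo] --> 'E_P'[g \o Z])%E.

Definition has_density_proportional_to (R : realType) (d : measure_display)
    (T : measurableType d) (P : probability T R) (F : {RV P >-> R})
    (rho : R -> R) : Prop :=
  exists2 c : R, 0 < c & forall A : set R, measurable A ->
    distribution P F A = (\int[lebesgue_measure]_(x in A) (c * rho x)%:E)%E.

(* Main.v *)
From HB Require Import structures.
Require Import Defs.
From mathcomp Require Import all_boot all_order all_algebra.
From mathcomp Require Import all_classical all_reals all_analysis.
From mathcomp Require Import measurable_realfun ring lra.

Set Implicit Arguments.
Unset Strict Implicit.
Unset Printing Implicit Defensive.
Import Order.TTheory GRing.Theory Num.Theory.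
Import numFieldTopology.Exports numFieldNormedType.Exports.

Local Open Scope classical_set_scope.
Local Open Scope ring_scope.

(** The theorem is about a single model.  At a type-II special point [potts_f]
    has, besides its vanishing first derivative, a vanishing second
    derivative (the quadratic form can only degenerate in the direction of the
    curve [s |-> x_s]), third derivative (it has a maximum) and fourth
    derivative.  In terms of the two levels of [x_s] these equations are
    algebraic, and [type2_special_point] finds that [p = 4], [q = 2],
    [beta = 2/3], [h = 0] and that the maximizer is the uniform vector
    [(1/2, 1/2)].

    For this model the law of the number [k] of sites of the first colour is
    explicit: its weight is a binomial coefficient times the exponential of a
    polynomial in [s = 1 - 2k/N].  The entropy is
    [ln 2 - s^2/2 - s^4/12 - s^6/30 - ...] and the energy cancels the terms of
    order 2 and 4.  With [x = N^(1/6) s / 2], the scaled coordinate of the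
    statement, the remaining term [- N s^6/30] is [- 32/15 x^6].  The
    perturbation of the field contributes
    [N * N^(-5/6) hbar (1 - s)/2], that is a constant minus [hbar x], while that
    of the inverse temperature is [O(N^(1/6) s^2) = O(N^(-1/6))] for bounded [x]
    and disappears.  Stirling's formula, with its constant left abstract, makes
    this precise: after a common scaling, the weight at the grid point [x]
    converges to a multiple of [exp (- 32/15 x^6 - hbar x)] ([psi_cvg]) and
    is bounded uniformly by a Gaussian ([psi_gauss]).

    The expectation of a bounded continuous function is then a quotient of two
    Riemann sums of mesh [N^(-5/6)].  Each is the integral of a step function on
    the line, to which dominated convergence applies ([weighted_sum_cvg]); the
    quotient of the limits is the expectation under the limiting density, by
    [expectation_density]. *)

(** * Derivatives of real functions and local maxima *)

Section derivatives.
Context {R : realType}.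
Implicit Types (f g : R -> R) (x a b c : R).

Lemma isder_cst c x : is_derive x 1 (fun=> c) 0.
Proof. exact: is_derive_cst. Qed.

Lemma isder_add f g x a b : is_derive x 1 f a -> is_derive x 1 g b ->
  is_derive x 1 (fun t => f t + g t) (a + b).
Proof. by move=> fa gb; exact: is_deriveD. Qed.

Lemma isder_opp f x a : is_derive x 1 f a ->
  is_derive x 1 (fun t => - f t) (- a).
Proof. by move=> fa; exact: is_deriveN. Qed.

Lemma isder_sub f g x a b : is_derive x 1 f a -> is_derive x 1 g b ->
  is_derive x 1 (fun t => f t - g t) (a - b).
Proof. by move=> fa gb; exact: is_deriveB. Qed.

Lemma isder_mul f g x a b : is_derive x 1 f a -> is_derive x 1 g b ->
  is_derive x 1 (fun t => f t * g t) (a * g x + f x * b).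
Proof.
move=> fa gb; apply: (is_derive_eq (is_deriveM fa gb)).
by rewrite addrC mulrC.
Qed.

Lemma isder_scale f c x a : is_derive x 1 f a ->
  is_derive x 1 (fun t => c * f t) (c * a).
Proof. by move=> fa; exact: (is_deriveZ c fa). Qed.

Lemma isder_exp n x : is_derive x 1 (fun t : R => t ^+ n) (n%:R * x ^+ n.-1).
Proof.
have -> : (fun t : R => t ^+ n) = id ^+ n.
  by apply/funext => t; rewrite fctE.
by apply: (is_derive_eq (is_deriveX n (is_derive_id x 1))); rewrite scaler1.
Qed.

Lemma isder_inv x : x != 0 -> is_derive x 1 (fun t : R => t^-1) (- x ^- 2).
Proof.
move=> x0; apply: (is_derive_eq (@is_deriveV _ id x 1 1 x0 (is_derive_id x 1))).
by rewrite scaler1.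
Qed.

Lemma isder_affine c d x : is_derive x 1 (fun t : R => c + d * t) d.
Proof.
have h := isder_add (is_derive_cst c x 1) (isder_scale d (is_derive_id x 1)).
by apply: (is_derive_eq h); rewrite add0r mulr1.
Qed.

Lemma isder_comp_affine f c d x a : is_derive (c + d * x) 1 f a ->
  is_derive x 1 (fun t => f (c + d * t)) (a * d).
Proof.
move=> fa; exact: (@is_derive1_comp R f (fun t => c + d * t) x a d fa
  (isder_affine c d x)).
Qed.

Lemma mean_value f f' a b : a < b ->
  (forall x, a <= x <= b -> is_derive x 1 f (f' x)) ->
  exists2 c, a < c < b & f b - f a = f' c * (b - a).
Proof.
move=> ab df; have [||c] := @MVT _ f f' a b ab.
- by move=> x; rewrite in_itv/= => /andP[ax xb]; apply: df; rewrite !ltW.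
- apply: derivable_within_continuous => x; rewrite in_itv/= => /df dfx.
  exact: (@ex_derive _ _ _ _ _ _ _ dfx).
- by rewrite in_itv/= => cab e; exists c.
Qed.

Lemma der_gt0_lt f f' a b : a < b ->
  (forall x, a <= x <= b -> is_derive x 1 f (f' x)) ->
  (forall x, a < x < b -> 0 < f' x) -> f a < f b.
Proof.
move=> ab df f0; have [c cab e] := mean_value ab df.
by rewrite -subr_gt0 e mulr_gt0 ?f0// subr_gt0.
Qed.

Lemma der_ge0_le f f' a b : a <= b ->
  (forall x, a <= x <= b -> is_derive x 1 f (f' x)) ->
  (forall x, a < x < b -> 0 <= f' x) -> f a <= f b.
Proof.
rewrite le_eqVlt => /predU1P[->//|ab] df f0.
have [c cab e] := mean_value ab df.
by rewrite -subr_ge0 e mulr_ge0 ?f0// subr_ge0 ltW.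
Qed.

(** A positive derivative at a single point: only a local comparison with the
    value at that point is available, not monotonicity. *)
Lemma der_gt0_near f a l : is_derive a 1 f l -> 0 < l ->
  exists2 e, 0 < e & (forall x, a < x < a + e -> f a < f x) /\
                     (forall x, a - e < x < a -> f x < f a).
Proof.
move=> /is_derive1_caratheodory[h [fh ch ha]] l0.
have : \forall x \near a, 0 < h x.
  by apply: (cvgr_gt _ ch 0); rewrite ha.
move=> /nbhs_ballP[e /= e0 he]; exists e => //.
split=> x /andP[x1 x2].
- rewrite -subr_gt0 fh mulr_gt0 ?subr_gt0// he//= /ball/=.
  by rewrite ltr0_norm; lra.
- rewrite -subr_lt0 fh pmulr_rlt0 ?subr_lt0// he//= /ball/=.
  by rewrite gtr0_norm; lra.
Qed.

(** Taylor's necessary conditions at a local maximum, up to order three. *)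
Lemma local_max_derivatives f f1 f2 s d l3 : 0 < d ->
  (forall x, s - d < x < s + d -> is_derive x 1 f (f1 x)) ->
  (forall x, s - d < x < s + d -> is_derive x 1 f1 (f2 x)) ->
  is_derive s 1 f2 l3 ->
  (forall x, s - d < x < s + d -> f x <= f s) ->
  [/\ f1 s = 0, f2 s <= 0 & f2 s = 0 -> l3 = 0].
Proof.
move=> d0 df df1 df2 fmax.
have sd : s - d < s < s + d by lra.
have small e : 0 < e -> exists m, [/\ 0 < m, m < e & m < d].
  move=> e0; exists (Num.min e d / 2).
  by split; rewrite /Num.min; case: ifPn; rewrite -?leNgt; lra.
(* [f] would exceed its maximum just after, resp. just before, [s]. *)
have right e : 0 < e -> (forall x, s < x < s + e -> 0 < f1 x) -> False.
  move=> e0 f1e; have [m [m0 me md]] := small e e0.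
  have sm : s - d < s + m < s + d by lra.
  have := fmax _ sm; rewrite leNgt => /negP; apply.
  apply: (@der_gt0_lt _ f1); first by lra.
    by move=> x /andP[? ?]; apply: df; lra.
  by move=> x /andP[? ?]; apply: f1e; lra.
have left e : 0 < e -> (forall x, s - e < x < s -> f1 x < 0) -> False.
  move=> e0 f1e; have [m [m0 me md]] := small e e0.
  have sm : s - d < s - m < s + d by lra.
  have := fmax _ sm; rewrite leNgt => /negP; apply.
  rewrite -ltrN2; apply: (@der_gt0_lt (fun t => - f t) (fun t => - f1 t)).
  - by lra.
  - by move=> x /andP[? ?]; apply: isder_opp; apply: df; lra.
  - by move=> x /andP[? ?]; rewrite oppr_gt0; apply: f1e; lra.
have f1s : f1 s = 0.
  apply/eqP; rewrite eq_le; apply/andP; split; rewrite leNgt; apply/negP => h.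
    have [e e0 [er _]] := der_gt0_near (df _ sd) h.
    have [m [m0 me md]] := small e e0.
    have sm : s - d < s + m < s + d by lra.
    have se : s < s + m < s + e by lra.
    by have := lt_le_trans (er _ se) (fmax _ sm); rewrite ltxx.
  have h' : 0 < - f1 s by lra.
  have [e e0 [_ er]] := der_gt0_near (isder_opp (df _ sd)) h'.
  have [m [m0 me md]] := small e e0.
  have sm : s - d < s - m < s + d by lra.
  have se : s - e < s - m < s by lra.
  have := er _ se; rewrite ltrN2 => se'.
  by have := lt_le_trans se' (fmax _ sm); rewrite ltxx.
have f2s : f2 s <= 0.
  rewrite leNgt; apply/negP => h.
  have [e e0 [er _]] := der_gt0_near (df1 _ sd) h.
  by apply: (right e e0) => x /er; rewrite f1s.
split=> // f2s0; apply/eqP; rewrite eq_le; apply/andP; split; rewrite leNgt;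
  apply/negP => h.
- have [e e0 [er _]] := der_gt0_near df2 h.
  have [m [m0 me md]] := small e e0.
  apply: (right _ m0) => x /andP[sx xm].
  rewrite -f1s; apply: (@der_gt0_lt _ f2) => //.
    by move=> y /andP[? ?]; apply: df1; lra.
  by move=> y /andP[? ?]; rewrite -f2s0; apply: er; lra.
- have h' : 0 < - l3 by lra.
  have [e e0 [_ er]] := der_gt0_near (isder_opp df2) h'.
  have [m [m0 me md]] := small e e0.
  apply: (left _ m0) => x /andP[xm xs].
  rewrite -f1s; apply: (@der_gt0_lt _ f2) => //.
    by move=> y /andP[? ?]; apply: df1; lra.
  move=> y /andP[? ?]; have ye : s - e < y < s by lra.
  by have := er _ ye; rewrite ltrN2 f2s0.
Qed.

End derivatives.

(** * The landscape along the curve of the maximizers *)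

Section landscape.
Context {R : realType} (q : nat) (hq : (1 < q)%N) (p : nat) (beta h : R).
Local Notation Q := (q%:R : R).
Local Notation D := (q%:R - 1 : R).
Local Notation c1 := (color1 hq).

(** The two values taken by the coordinates of [potts_x hq s]. *)
Definition major (s : R) : R := Q^-1 + D / Q * s.
Definition minor (s : R) : R := Q^-1 + - Q^-1 * s.

Definition entropy_der (k : nat) (t : R) : R :=
  match k with
  | 0 => t * ln t
  | 1 => ln t + 1
  | 2 => t^-1
  | 3 => - t ^- 2
  | 4 => 2 * t ^- 3
  | _ => 0
  end.

(** The [k]-th derivative, for [k <= 4], of the one-coordinate part
    [beta t^p - t log t] of the landscape. *)
Definition phi (k : nat) (t : R) : R :=
  beta * (p ^_ k)%:R * t ^+ (p - k) - entropy_der k t.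

Definition field_der (k : nat) (s : R) : R :=
  match k with 0 => h * major s | 1 => h * (D / Q) | _ => 0 end.

(** The [k]-th derivative of [potts_f] for [k <= 4], by the chain rule along
    the line [s |-> x_s]. *)
Definition profile (k : nat) (s : R) : R :=
  (D / Q) ^+ k * phi k (major s) + D * ((- Q^-1) ^+ k * phi k (minor s))
  + field_der k s.

Lemma colors_gt1 : 1 < Q. Proof. by rewrite ltr1n. Qed.
Let Q0 : 0 < Q. Proof. by have := colors_gt1; lra. Qed.
Let D0 : 0 < D. Proof. by have := colors_gt1; lra. Qed.

Lemma potts_xE s r : potts_x hq s r 0 = if r == c1 then major s else minor s.
Proof.
by rewrite mxE /major /minor; case: ifP => _; field; apply: lt0r_neq0.
Qed.

Lemma sum_color1 (G : 'I_q -> R) :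
  \sum_(r < q) G r = G c1 + \sum_(r < q | r != c1) G r.
Proof. by rewrite (bigD1 c1). Qed.

Lemma sum_other_colors (c : R) : \sum_(r < q | r != c1) c = D * c.
Proof.
have := @sum_color1 (fun=> c); rewrite sumr_const card_ord => e.
by rewrite mulrBl mul1r mulr_natl e addrC addKr.
Qed.

Lemma sum_two_level (G : R -> R) s :
  \sum_(r < q) G (potts_x hq s r 0) = G (major s) + D * G (minor s).
Proof.
rewrite sum_color1 potts_xE eqxx; congr (_ + _).
rewrite -sum_other_colors; apply: eq_bigr => r rc.
by rewrite potts_xE (negbTE rc).
Qed.

Lemma potts_fE s : potts_f hq p beta h s = profile 0 s.
Proof.
rewrite /potts_f /potts_H (sum_two_level (fun t => t ^+ p)).
rewrite (sum_two_level (fun t => t * ln t)) potts_xE eqxx.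
by rewrite /profile /phi /= !expr0 ffactn0 subn0; lra.
Qed.

Lemma der_phi k (t : R) : (k <= 3)%N -> 0 < t ->
  is_derive t 1 (phi k) (phi k.+1 t).
Proof.
move=> k3 t0; rewrite /phi.
have t_neq0 : t != 0 by rewrite gt_eqF.
apply: isder_sub.
  apply: (is_derive_eq (isder_scale _ (isder_exp (p - k) t))).
  by rewrite ffactnSr natrM subnS; lra.
case: k k3 => [|[|[|[|//]]]] _ /=.
- apply: (is_derive_eq (isder_mul (is_derive_id t 1) (is_derive1_ln t0))).
  by rewrite divff// mul1r.
- apply: (is_derive_eq (isder_add (is_derive1_ln t0) (isder_cst 1 t))).
  by rewrite addr0.
- exact: isder_inv.
- have t2_neq0 : t ^+ 2 != 0 by rewrite expf_neq0.
  have dV := @is_deriveV R (fun u => u ^+ 2) t _ 1 t2_neq0 (isder_exp 2 t).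
  by apply: (is_derive_eq (isder_opp dV)); rewrite /GRing.scale /=; field.
Qed.

Lemma major_gt0 (s : R) : - D^-1 < s -> 0 < major s.
Proof.
move=> s0; rewrite /major [X in 0 < X](_ : _ = D / Q * (s + D^-1)).
  by rewrite mulr_gt0 ?divr_gt0//; lra.
by field; rewrite !gt_eqF.
Qed.

Lemma minor_gt0 (s : R) : s < 1 -> 0 < minor s.
Proof.
move=> s0; rewrite /minor [X in 0 < X](_ : _ = Q^-1 * (1 - s)).
  by rewrite mulr_gt0 ?invr_gt0//; lra.
by field; rewrite !gt_eqF.
Qed.

Lemma der_profile k (s : R) : (k <= 3)%N -> - D^-1 < s < 1 ->
  is_derive s 1 (profile k) (profile k.+1 s).
Proof.
move=> k3 /andP[s0 s1].
have dx := isder_scale ((D / Q) ^+ k)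
  (isder_comp_affine (der_phi k3 (major_gt0 s0))).
have dy := isder_scale D (isder_scale ((- Q^-1) ^+ k)
  (isder_comp_affine (der_phi k3 (minor_gt0 s1)))).
have dh : is_derive s 1 (field_der k) (field_der k.+1 s).
  case: k {k3 dx dy} => [|[|k]]; try exact: isder_cst.
  exact: (isder_scale h (isder_affine _ _ _)).
apply: (is_derive_eq (isder_add (isder_add dx dy) dh)).
by rewrite /profile !exprS /major /minor; ring.
Qed.

Lemma potts_f_derive1n k (s : R) : (k <= 4)%N -> - D^-1 < s < 1 ->
  ((potts_f hq p beta h)^`(k))%classic s = profile k s.
Proof.
elim: k s => [|k IH] s k4 sI; first by rewrite derive1n0 potts_fE.
rewrite derive1nS derive1E.
have := der_profile k4 sI => /@derive_val <-.
apply: near_eq_derive.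
have : \forall t \near s, t \in `](- D^-1), 1[.
  by apply: near_in_itvoo; rewrite in_itv.
by apply: filterS => t; rewrite in_itv/= => tI; exact: IH (ltnW k4) tI.
Qed.

Lemma potts_x_simplex (s : R) : - D^-1 < s < 1 -> simplex (potts_x hq s).
Proof.
move=> /andP[s0 s1]; split.
  by move=> r; rewrite potts_xE; case: ifP => _; apply: ltW;
    [exact: major_gt0|exact: minor_gt0].
rewrite (sum_two_level id) /major /minor; field; exact: lt0r_neq0.
Qed.

(** The curve [s |-> x_s] stays in the simplex a little to the left of [s = 0],
    so that even there [s] is an interior maximum of [potts_f]. *)
Lemma maximizer_profile (s : R) : 0 <= s < 1 ->
  global_maximizer hq p beta h (potts_x hq s) ->
  [/\ profile 1 s = 0, profile 2 s <= 0 & profile 2 s = 0 -> profile 3 s = 0].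
Proof.
move=> /andP[s0 s1] [_ smax].
pose d := Num.min (D^-1) (1 - s).
have Di : 0 < D^-1 by rewrite invr_gt0.
have d0 : 0 < d by rewrite lt_min Di; lra.
have inside x : s - d < x < s + d -> - D^-1 < x < 1.
  have : d <= D^-1 by rewrite ge_min lexx.
  have : d <= 1 - s by rewrite ge_min lexx orbT.
  by move=> ? ? ?; lra.
have df k x : (k <= 3)%N -> s - d < x < s + d ->
    is_derive x 1 (profile k) (profile k.+1 x).
  by move=> k3 /inside; exact: der_profile.
have sd : s - d < s < s + d by lra.
have pmax x : s - d < x < s + d -> profile 0 x <= profile 0 s.
  by move=> /inside xI; rewrite -!potts_fE; exact/smax/potts_x_simplex.
exact: (local_max_derivatives d0 (fun x => df 0 x isT) (fun x => df 1 x isT)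
  (df 2 s isT sd) pmax).
Qed.

End landscape.

(** * Classification of the type-II special points *)

Section classification.
Context {R : realType} (q : nat) (hq : (1 < q)%N) (p : nat) (hp : (1 < p)%N)
  (beta h : R) (hbeta : 0 < beta) (hh : 0 <= h).
Local Notation Q := (q%:R : R).
Local Notation D := (q%:R - 1 : R).
Local Notation c1 := (color1 hq).
Local Notation phi := (phi p beta).
Local Notation major := (@major R q).
Local Notation minor := (@minor R q).
Local Notation profile := (profile q p beta h).

Let Q0 : 0 < Q. Proof. by have := @colors_gt1 R q hq; lra. Qed.
Let D0 : 0 < D. Proof. by have := @colors_gt1 R q hq; lra. Qed.
Let D1 : 1 <= D. Proof. by rewrite lerBrDr -(natrD _ 1 1) ler_nat. Qed.

Lemma mulr_phi2 (t : R) : 0 < t ->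
  t * phi 2 t = beta * (p ^_ 2)%:R * t ^+ p.-1 - 1.
Proof.
move=> t0; rewrite /phi /=.
have -> : t ^+ p.-1 = t * t ^+ (p - 2).
  by rewrite -exprS; congr (_ ^+ _); case: (p) hp => [|[|n]] //= _; rewrite subn2.
by field; rewrite gt_eqF.
Qed.

Lemma mulr_phi3 n (t : R) : p = n.+2 -> 0 < t ->
  t ^+ 2 * phi 3 t = n%:R * (beta * (p ^_ 2)%:R * t ^+ n.+1) + 1.
Proof.
move=> pE t0; have t_neq0 : t != 0 by rewrite gt_eqF.
rewrite /phi /= ffactnSr pE !subSS !subn0 natrM.
case: n {pE} => [|n]; first by field.
by rewrite subSS subn0 !exprS; field.
Qed.

Lemma mulr_phi4 n (t : R) : p = n.+2 -> 0 < t ->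
  t ^+ 3 * phi 4 t = n%:R * (n%:R - 1) * (beta * (p ^_ 2)%:R * t ^+ n.+1) - 2.
Proof.
move=> pE t0; have t_neq0 : t != 0 by rewrite gt_eqF.
rewrite /phi /= 2!ffactnSr pE !subSS !subn0 !natrM.
case: n {pE} => [|[|n]]; [by field|by rewrite subnn; field|].
have nE : n.+2%:R = n.+1%:R + 1 :> R by rewrite -[n.+2]addn1 natrD.
by rewrite !subSS !subn0 nE !exprS; field.
Qed.

Lemma phi2_ge0_gt0 (t u : R) : 0 < t -> t < u -> 0 <= phi 2 t -> 0 < phi 2 u.
Proof.
move=> t0 tu h0; have u0 : 0 < u by lra.
rewrite -(pmulr_rgt0 _ u0) mulr_phi2//.
have : 0 <= t * phi 2 t by rewrite mulr_ge0// ltW.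
rewrite mulr_phi2// => /le_lt_trans; apply.
rewrite ltrD2r ltr_pM2l; last first.
  by rewrite mulr_gt0// ltr0n ffact_gt0.
by rewrite ltr_pXn2r ?nnegrE ?ltW//; case: (p) hp => [|[|]].
Qed.

(** The first-order condition makes [phi 1] take at the minor level at least
    its value at the major one; as [phi 1] is decreasing and then
    increasing, it still decreases at the minor level. *)
Lemma phi2_minor_lt0 (s : R) : 0 < s < 1 -> profile 1 s = 0 ->
  phi 2 (minor s) < 0.
Proof.
move=> /andP[s0 s1] p1; rewrite ltNge; apply/negP => b0.
have y0 : 0 < minor s by exact: minor_gt0.
have yx : minor s < major s.
  have e : major s - minor s = s by rewrite /major /minor; field; exact: lt0r_neq0.
  by lra.
have e : phi 1 (major s) + h = phi 1 (minor s).
  have -> : phi 1 (minor s) = phi 1 (major s) + h - Q / D * profile 1 s.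
    by rewrite /profile /field_der !expr1; field; rewrite !gt_eqF.
  by rewrite p1; lra.
have : phi 1 (minor s) < phi 1 (major s).
  apply: (der_gt0_lt yx (f' := phi 2)) => t /andP[t0 t1].
    by apply: der_phi => //; lra.
  exact: phi2_ge0_gt0 b0.
by rewrite -e gtrDl ltNge hh.
Qed.

Lemma potts_QE (s : R) (t : 'cV[R]_q) : potts_Q p beta (potts_x hq s) t =
  phi 2 (major s) * t c1 0 ^+ 2
  + phi 2 (minor s) * \sum_(r < q | r != c1) t r 0 ^+ 2.
Proof.
have phi2E u : phi 2 u = beta * (p%:R * (p%:R - 1)) * u ^+ (p - 2) - u^-1.
  by rewrite /phi ffactnS ffactn1 natrM -subn1 natrB 1?ltnW.
rewrite /potts_Q (sum_color1 hq) potts_xE eqxx -phi2E; congr (_ + _).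
rewrite mulr_sumr; apply: eq_bigr => r rc.
by rewrite potts_xE (negbTE rc) -phi2E.
Qed.

(** For [s = 0] the form is a multiple of the square norm.  For [s > 0] its
    coefficient on the minor coordinates is negative, so that, among the
    vectors of zero sum with a given first coordinate, it is largest in the
    direction of the curve [s |-> x_s] (Cauchy-Schwarz). *)
Lemma singular_profile2 (s : R) : 0 <= s < 1 ->
  profile 1 s = 0 -> profile 2 s <= 0 ->
  singular_at p beta (potts_x hq s) -> profile 2 s = 0.
Proof.
move=> /andP[s0 s1] p1 p2 [t [t_sum t_neq0]]; rewrite potts_QE => Qt.
set S := \sum_(r < q | r != c1) t r 0 ^+ 2 in Qt.
set a := phi 2 (major s) in Qt; set b := phi 2 (minor s) in Qt.
have p2E : profile 2 s = D / Q ^+ 2 * (D * a + b).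
  by rewrite /profile /field_der -/a -/b; field; rewrite gt_eqF.
have S0 : 0 <= S by apply: sumr_ge0 => r _; exact: sqr_ge0.
have norm_gt0 : 0 < t c1 0 ^+ 2 + S.
  rewrite lt_neqAle addr_ge0 ?sqr_ge0// andbT eq_sym paddr_eq0 ?sqr_ge0//.
  apply: contra t_neq0 => /andP[t1 St]; apply/eqP/colP => r; rewrite mxE.
  have [->|rc] := eqVneq r c1; first by apply/eqP; rewrite -sqrf_eq0.
  move: St; rewrite psumr_eq0; last by move=> *; exact: sqr_ge0.
  move=> /allP/(_ r); rewrite mem_index_enum rc sqrf_eq0 => /(_ isT).
  by move=> /eqP.
have p2_ge0 : 0 <= D * a + b -> profile 2 s = 0.
  move=> ab; apply/eqP; rewrite eq_le p2 p2E.
  by rewrite mulr_ge0// divr_ge0 ?exprn_ge0// ltW.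
move: s0; rewrite le_eqVlt => /predU1P[s0|s0].
  have ab : a = b by rewrite /a /b -s0 /major /minor !mulr0.
  apply: p2_ge0; suff a0 : a = 0 by rewrite -ab a0 mulr0 addr0.
  move: Qt; rewrite -ab -mulrDr => /eqP; rewrite mulf_eq0.
  by rewrite (gt_eqF norm_gt0) orbF => /eqP.
have b0 : b < 0 by apply: phi2_minor_lt0 => //; rewrite s0.
have CS : t c1 0 ^+ 2 <= D * S.
  have := t_sum; rewrite /zero_sum/= (sum_color1 hq) => ts.
  have : 0 <= \sum_(r < q | r != c1) (t r 0 + t c1 0 / D) ^+ 2.
    by apply: sumr_ge0 => r _; exact: sqr_ge0.
  have -> : \sum_(r < q | r != c1) (t r 0 + t c1 0 / D) ^+ 2
      = S + 2 * (t c1 0 / D) * \sum_(r < q | r != c1) t r 0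
        + D * (t c1 0 / D) ^+ 2.
    rewrite -(sum_other_colors hq) mulr_sumr -!big_split/=.
    by apply: eq_bigr => r _; ring.
  have -> : \sum_(r < q | r != c1) t r 0 = - t c1 0 by lra.
  move=> CS; rewrite -subr_ge0 [X in 0 <= X](_ : _ = D * (S
    + 2 * (t c1 0 / D) * - t c1 0 + D * (t c1 0 / D) ^+ 2)).
    by rewrite mulr_ge0// ltW.
  by field; rewrite gt_eqF.
have t1 : 0 < t c1 0 ^+ 2.
  rewrite lt_neqAle sqr_ge0 andbT eq_sym; apply/negP => /eqP t10.
  move: Qt norm_gt0; rewrite t10 mulr0 !add0r => /eqP.
  by rewrite mulf_eq0 (lt_eqF b0)/= => /eqP ->; rewrite ltxx.
apply: p2_ge0; rewrite -(pmulr_rge0 _ t1).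
have -> : t c1 0 ^+ 2 * (D * a + b) = b * (t c1 0 ^+ 2 - D * S).
  have -> : t c1 0 ^+ 2 * (D * a + b) = D * (a * t c1 0 ^+ 2) + b * t c1 0 ^+ 2.
    by ring.
  have -> : a * t c1 0 ^+ 2 = - (b * S) by lra.
  by ring.
by rewrite nmulr_rge0//; lra.
Qed.

(** With [n = p - 2], [D = q - 1], [x], [y] the two levels, [rho = D y / x]
    and [A], [B] the numbers [beta p (p-1) x^(p-1)] and
    [beta p (p-1) y^(p-1)], the vanishing of the derivatives of order 2, 3, 4
    reads as the first three equations below.  They give
    [n A + 1 = (n+1) / rho], [n B + 1 = (n+1) rho] and
    [rho^2 - n rho + 1 = 0]; the relation between [A] and [B] then becomes
    [D^(n+1) rho^2 = rho^n], which forces [D = rho = 1], since [x >= y] means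
    [rho <= D] and since [D >= 1]. *)
Lemma degenerate_algebra (n : nat) (d rho A B : R) :
  1 <= d -> 0 < rho -> rho <= d ->
  (A - 1) * rho + (B - 1) = 0 ->
  (n%:R * A + 1) * rho ^+ 2 = n%:R * B + 1 ->
  (n%:R * (n%:R - 1) * A - 2) * rho ^+ 3 + (n%:R * (n%:R - 1) * B - 2) = 0 ->
  A * rho ^+ n.+1 = B * d ^+ n.+1 ->
  [/\ n = 2%N, d = 1 & rho = 1].
Proof.
move=> d1 r0 rd e2 e3 e4 e5.
have n0 : n != 0%N.
  apply/negP => /eqP n0; move: e4; rewrite n0 !mul0r !sub0r.
  have : 0 < rho ^+ 3 by rewrite exprn_gt0.
  by lra.
have nR : 0 < n%:R :> R by rewrite ltr0n lt0n.
set nn : R := n%:R in e3 e4 nR *.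
have alpha : (nn * A + 1) * rho = nn + 1.
  have : (1 + rho) * ((nn * A + 1) * rho - (nn + 1)) = 0.
    transitivity (nn * ((A - 1) * rho + (B - 1))
      + ((nn * A + 1) * rho ^+ 2 - (nn * B + 1))); first by ring.
    by rewrite e2 e3; ring.
  by move/eqP; rewrite mulf_eq0 gt_eqF ?addr_gt0//= => /eqP; lra.
have gamma : nn * B + 1 = (nn + 1) * rho.
  by rewrite -e3 -alpha; ring.
have quad : rho ^+ 2 - nn * rho + 1 = 0.
  have : (nn + 1) * (rho + 1) * (rho ^+ 2 - nn * rho + 1) = 0.
    transitivity (- (((nn - 1) * (nn * A + 1) - (nn + 1)) * rho ^+ 3
       + ((nn - 1) * (nn * B + 1) - (nn + 1)))
       + (nn - 1) * rho ^+ 2 * ((nn * A + 1) * rho - (nn + 1))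
       + (nn - 1) * (nn * B + 1 - (nn + 1) * rho)); first by ring.
    rewrite alpha gamma !subrr !mulr0 !addr0.
    rewrite -gamma -[RHS]oppr0 -e4; ring.
  have nn1 : nn + 1 != 0 by rewrite gt_eqF// addr_gt0.
  have r1 : rho + 1 != 0 by rewrite gt_eqF// addr_gt0.
  by move/eqP; rewrite !mulf_eq0 (negbTE nn1) (negbTE r1) => /eqP.
have pow : d ^+ n.+1 * rho ^+ 2 = rho ^+ n.
  have : (1 + rho) * (d ^+ n.+1 * rho ^+ 2 - rho ^+ n) = 0.
    have : nn * rho * (A * rho ^+ n.+1) = nn * rho * (B * d ^+ n.+1) by rewrite e5.
    have -> : nn * rho * (A * rho ^+ n.+1) = rho ^+ n.+1 * (nn + 1 - rho).
      by rewrite -alpha; ring.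
    have -> : nn * rho * (B * d ^+ n.+1) = rho * d ^+ n.+1 * ((nn + 1) * rho - 1).
      by rewrite -gamma; ring.
    have -> : (nn + 1) * rho - 1 = rho ^+ 2 + rho by lra.
    have -> : rho ^+ n.+1 * (nn + 1 - rho) = rho ^+ n * (1 + rho).
      rewrite exprS mulrC mulrA mulrC; congr (_ * _).
      by lra.
    by move=> e; rewrite -[RHS](subrr (rho ^+ n * (1 + rho))) {1}e; ring.
  by move/eqP; rewrite mulf_eq0 gt_eqF ?addr_gt0//= subr_eq0 => /eqP.
have d0 : 0 < d by lra.
have r1 : rho <= 1.
  rewrite leNgt; apply/negP => r1.
  have : rho ^+ n.+1 * rho ^+ 2 <= rho ^+ n.
    by rewrite -pow ler_wpM2r ?sqr_ge0// lerXn2r// nnegrE ltW.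
  rewrite -exprD ler_eXn2l// addnC addnS; apply/negP.
  by rewrite -ltnNge ltnS leq_addl.
have n2 : (2 <= n)%N.
  rewrite ltnNge; apply/negP => n1.
  have e : nn = 1 by rewrite /nn; case: (n) n0 n1 => [|[|]].
  move: quad; rewrite e; have := sqr_ge0 (rho - 1/2).
  have -> : (rho - 1/2) ^+ 2 = rho ^+ 2 - rho + 1/4 by field.
  by lra.
have d1' : d = 1.
  apply/eqP; rewrite eq_le d1 andbT leNgt; apply/negP => dgt.
  have : rho ^+ n <= rho ^+ 2 by rewrite ler_wiXn2l// ltW.
  rewrite -pow leNgt => /negP; apply.
  by rewrite ltr_pMl ?exprn_gt0// exprn_egt1.
have r1' : rho = 1.
  apply/eqP; rewrite eq_le r1/= leNgt; apply/negP => rlt.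
  have n3 : (2 < n)%N.
    rewrite ltn_neqAle n2 andbT; apply/negP => /eqP e.
    move: quad; rewrite /nn -e.
    have -> : rho ^+ 2 - 2 * rho + 1 = (1 - rho) ^+ 2 by ring.
    by move=> /eqP; rewrite sqrf_eq0 => /eqP; lra.
  have : rho ^+ n < rho ^+ 2 by rewrite ltr_iXn2l.
  by rewrite -pow d1' expr1n mul1r ltxx.
split=> //; apply/eqP; rewrite -(eqr_nat R) -/nn; apply/eqP.
by move: quad; rewrite r1'; lra.
Qed.

(** A type-II special maximizer is a critical point of [potts_f] at which the
    derivatives of order 2, 3 and 4 vanish too (order 3 because it is a
    maximum).  These four equations have a single solution: the degenerate
    critical point of the four-spin Curie-Weiss model, without field. *)
Theorem type2_special_point (m : 'cV[R]_q) :
  type2_special hq p beta h -> unique_global_maximizer hq p beta h m ->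
  [/\ p = 4%N, q = 2%N, beta = 2 / 3, h = 0 & m = potts_x hq 0].
Proof.
move=> [s [[sI smax ssing] f4]] mmax.
have mE : m = potts_x hq s by apply: smax.2; exact: mmax.1.
have [p1 p2_le0 p3_imp] := maximizer_profile sI smax.1.
have p2 := singular_profile2 sI p1 p2_le0 ssing.
have p3 := p3_imp p2.
have sI' : - D^-1 < s < 1.
  have : 0 < D^-1 by rewrite invr_gt0.
  by lra.
have p4 : profile 4 s = 0 by rewrite -(potts_f_derive1n hq p beta h).
move/andP: sI' => [s0 s1].
have x0 := major_gt0 hq s0; have y0 := minor_gt0 hq s1.
pose x := major s; pose y := minor s; rewrite -/x in x0; rewrite -/y in y0.
have [n pE] : exists n, p = n.+2 by exists p.-2; case: (p) hp => [|[|]].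
pose A := beta * (p ^_ 2)%:R * x ^+ n.+1.
pose B := beta * (p ^_ 2)%:R * y ^+ n.+1.
pose rho := D * y / x.
have x_neq0 : x != 0 by rewrite gt_eqF.
have y_neq0 : y != 0 by rewrite gt_eqF.
have Q_neq0 : Q != 0 by rewrite gt_eqF.
have D_neq0 : D != 0 by rewrite gt_eqF.
have A2 : x * phi 2 x = A - 1 by rewrite mulr_phi2// /A pE.
have B2 : y * phi 2 y = B - 1 by rewrite mulr_phi2// /B pE.
have A3 : x ^+ 2 * phi 3 x = n%:R * A + 1 by rewrite (mulr_phi3 pE).
have B3 : y ^+ 2 * phi 3 y = n%:R * B + 1 by rewrite (mulr_phi3 pE).
have A4 : x ^+ 3 * phi 4 x = n%:R * (n%:R - 1) * A - 2 by rewrite (mulr_phi4 pE).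
have B4 : y ^+ 3 * phi 4 y = n%:R * (n%:R - 1) * B - 2 by rewrite (mulr_phi4 pE).
have yx : y <= x.
  have e : x - y = s by rewrite /x /y /major /minor; field.
  by move/andP: sI => [? _]; lra.
have [|||||||n2 d1 rho1] := @degenerate_algebra n D rho A B.
- exact: D1.
- by rewrite divr_gt0// mulr_gt0.
- by rewrite ler_pdivrMr// ler_pM2l.
- transitivity (y * Q ^+ 2 / D * profile 2 s).
    by rewrite -A2 -B2 /profile /field_der -/x -/y /rho; field;
      rewrite ?D_neq0 ?x_neq0 ?Q_neq0.
  by rewrite p2 mulr0.
- apply/eqP; rewrite -subr_eq0; apply/eqP.
  transitivity (y ^+ 2 * Q ^+ 3 / D * profile 3 s).
    by rewrite -A3 -B3 /profile /field_der -/x -/y /rho; field;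
      rewrite ?D_neq0 ?x_neq0 ?Q_neq0.
  by rewrite p3 mulr0.
- transitivity (y ^+ 3 * Q ^+ 4 / D * profile 4 s).
    by rewrite -A4 -B4 /profile /field_der -/x -/y /rho; field;
      rewrite ?D_neq0 ?x_neq0 ?Q_neq0.
  by rewrite p4 mulr0.
- rewrite /A /B /rho !exprMn exprVn; field.
  by rewrite expf_neq0.
have q2 : q = 2%N.
  by apply/eqP; rewrite -(eqr_nat R); apply/eqP; lra.
have xy : x = y.
  by rewrite -[RHS](divfK x_neq0) -[y]mul1r -d1 -/rho rho1 mul1r.
have s_eq0 : s = 0.
  have e : x - y = s by rewrite /x /y /major /minor; field.
  by rewrite -e xy subrr.
have xE : x = 1 / 2 by rewrite /x /major s_eq0 q2; field.
split=> //.
- by rewrite pE n2.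
- have A1 : A = 1.
    have AB : A = B by rewrite /A xy.
    have : x * phi 2 x = 0.
      have : profile 2 s = Q^-1 ^+ 2 * (D + 1) * D * phi 2 x.
        by rewrite /profile /field_der -/x -/y -xy; field.
      rewrite p2 d1 => /esym/eqP; rewrite mulf_eq0.
      move=> /orP[|/eqP ->]; last by rewrite mulr0.
      by rewrite q2 mulf_eq0; lra.
    by rewrite A2; lra.
  move: A1; rewrite /A pE n2 xE.
  have -> : ((4 ^_ 2)%N%:R = 12 :> R) by [].
  by lra.
- have : profile 1 s = h / 2.
    by rewrite /profile /field_der -/x -/y -xy q2; field.
  by rewrite p1; lra.
- by rewrite mE s_eq0.
Qed.

End classification.

(** * The rate function of a fair coin *)

Section log_bounds.
Context {R : realType}.

Lemma ln1D_lower (z : R) : 0 <= z -> 2 * z / (2 + z) <= ln (1 + z).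
Proof.
move=> z0.
pose g (t : R) := ln (1 + 1 * t) - (2 - 4 * (2 + 1 * t)^-1).
pose g' (t : R) := (1 + 1 * t)^-1 * 1 - (0 - 4 * (- (2 + 1 * t) ^- 2 * 1)).
have g0 : g 0 <= g z.
  apply: (der_ge0_le z0 (f' := g')) => t /andP[t0 tz].
    have p1 : 0 < 1 + 1 * t by lra.
    have p2 : 2 + 1 * t != 0 by rewrite gt_eqF//; lra.
    exact: (isder_sub (isder_comp_affine (is_derive1_ln p1)) (isder_sub
      (isder_cst 2 t) (isder_scale 4 (isder_comp_affine (isder_inv p2))))).
  have -> : g' t = t ^+ 2 / ((1 + t) * (2 + t) ^+ 2).
    by rewrite /g'; field; rewrite !gt_eqF//; lra.
  by rewrite divr_ge0 ?sqr_ge0// mulr_ge0 ?sqr_ge0//; lra.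
move: g0; rewrite /g !mulr0 !addr0 ln1 !mul1r.
have -> : 2 * z / (2 + z) = 2 - 4 / (2 + z) by field; rewrite gt_eqF//; lra.
by lra.
Qed.

Lemma ln1D_upper (z : R) : 0 <= z -> ln (1 + z) <= z * (2 + z) / (2 * (1 + z)).
Proof.
move=> z0.
pose g (t : R) := 1 / 2 + 1 / 2 * t - 1 / 2 * (1 + 1 * t)^-1 - ln (1 + 1 * t).
pose g' (t : R) := 1 / 2 - 1 / 2 * (- (1 + 1 * t) ^- 2 * 1) - (1 + 1 * t)^-1 * 1.
have g0 : g 0 <= g z.
  apply: (der_ge0_le z0 (f' := g')) => t /andP[t0 tz].
    have p1 : 0 < 1 + 1 * t by lra.
    exact: (isder_sub (isder_sub (isder_affine (1 / 2) (1 / 2) t) (isder_scale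
      (1 / 2) (isder_comp_affine (isder_inv (lt0r_neq0 p1)))))
      (isder_comp_affine (is_derive1_ln p1))).
  have -> : g' t = t ^+ 2 / (2 * (1 + t) ^+ 2).
    by rewrite /g'; field; rewrite !gt_eqF//; lra.
  by rewrite divr_ge0 ?sqr_ge0// mulr_ge0 ?sqr_ge0//; lra.
move: g0; rewrite /g !mulr0 !addr0 ln1 !mul1r invr1.
have -> : z * (2 + z) / (2 * (1 + z)) = (1 + z) / 2 - (1 + z)^-1 / 2.
  by field; rewrite gt_eqF//; lra.
by lra.
Qed.

(** The rate function of the fair coin: [ln 2] minus the entropy of the
    probability vector [((1 + s) / 2, (1 - s) / 2)]. *)
Definition coin_rate (s : R) : R :=
  ((1 + s) * ln (1 + s) + (1 - s) * ln (1 - s)) / 2.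

(** What is left of [coin_rate] after its Taylor polynomial of order 6.  The
    energy at the special point cancels the terms of order 2 and 4 and
    leaves [s^6 / 30]. *)
Definition coin_remainder (s : R) : R :=
  coin_rate s - s ^+ 2 / 2 - s ^+ 4 / 12 - s ^+ 6 / 30.

Lemma coin_remainderN s : coin_remainder (- s) = coin_remainder s.
Proof.
by rewrite /coin_remainder /coin_rate opprK; ring.
Qed.

(* The derivative of [coin_remainder]: [artanh s] minus its Taylor
   polynomial. *)
Let atanh (s : R) : R :=
  (ln (1 + s) - ln (1 - s)) / 2 - s - s ^+ 3 / 3 - s ^+ 5 / 5.

Let der_atanh (s : R) : -1 < s < 1 ->
  is_derive s 1 atanh (s ^+ 6 / (1 - s ^+ 2)).
Proof.
move=> /andP[s0 s1].
have p0 : 0 < 1 + 1 * s by lra.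
have m0 : 0 < 1 + -1 * s by lra.
have lnp := isder_comp_affine (is_derive1_ln p0).
have lnm := isder_comp_affine (is_derive1_ln m0).
have h := isder_sub (isder_sub (isder_sub
  (isder_scale 2^-1 (isder_sub lnp lnm)) (isder_affine 0 1 s))
  (isder_scale 3^-1 (isder_exp 3 s))) (isder_scale 5^-1 (isder_exp 5 s)).
have -> : atanh = fun t => 2^-1 * (ln (1 + 1 * t) - ln (1 + -1 * t))
    - (0 + 1 * t) - 3^-1 * t ^+ 3 - 5^-1 * t ^+ 5.
  by apply/funext => t; rewrite /atanh !mul1r mulN1r add0r; ring.
apply: (is_derive_eq h); rewrite /=; field.
have ss : 1 - s ^+ 2 = (1 - s) * (1 + s) by ring.
by rewrite ss !gt_eqF ?mulr_gt0//; lra.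
Qed.

Let der_coin_remainder (s : R) : -1 < s < 1 ->
  is_derive s 1 coin_remainder (atanh s).
Proof.
move=> /andP[s0 s1].
have p0 : 1 + 1 * s > 0 by lra.
have m0 : 1 + -1 * s > 0 by lra.
have xlnx (t : R) : 0 < t -> is_derive t 1 (fun t => t * ln t) (ln t + 1).
  move=> t0; apply: (is_derive_eq (isder_mul (is_derive_id t 1) (is_derive1_ln t0))).
  by rewrite mul1r divff// gt_eqF.
have h := isder_sub (isder_sub (isder_sub (isder_scale 2^-1 (isder_add
  (isder_comp_affine (xlnx _ p0)) (isder_comp_affine (xlnx _ m0))))
  (isder_scale 2^-1 (isder_exp 2 s))) (isder_scale 12^-1 (isder_exp 4 s)))
  (isder_scale 30^-1 (isder_exp 6 s)).
have -> : coin_remainder = fun t => 2^-1 * ((1 + 1 * t) * ln (1 + 1 * t)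
    + (1 + -1 * t) * ln (1 + -1 * t)) - 2^-1 * t ^+ 2 - 12^-1 * t ^+ 4
    - 30^-1 * t ^+ 6.
  by apply/funext => t; rewrite /coin_remainder /coin_rate !mul1r mulN1r; ring.
apply: (is_derive_eq h); rewrite /atanh !mul1r !mulN1r /=; lra.
Qed.

Let atanh_bounds (s : R) : 0 <= s < 1 ->
  0 <= atanh s /\ (s <= 1 / 2 -> atanh s <= 2 / 7 * s ^+ 7).
Proof.
move=> /andP[s0 s1].
have a0 : atanh 0 = 0 by rewrite /atanh addr0 !subr0 ln1 !expr0n /=; lra.
split=> [|s2].
  rewrite -a0; apply: (der_ge0_le s0 (f' := fun s => s ^+ 6 / (1 - s ^+ 2))).
    by move=> t /andP[? ?]; apply: der_atanh; lra.
  move=> t /andP[? ?]; rewrite divr_ge0 ?exprn_ge0//; try lra.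
  by nra.
rewrite -subr_ge0; have -> : 0 = 2 / 7 * 0 ^+ 7 - atanh 0 by rewrite a0 expr0n /=; lra.
apply: (der_ge0_le s0 (f := fun s => 2 / 7 * s ^+ 7 - atanh s)
  (f' := fun s => 2 / 7 * (7 * s ^+ 6) - s ^+ 6 / (1 - s ^+ 2))).
  move=> t /andP[? ?]; apply: isder_sub.
    exact: (isder_scale (2 / 7) (isder_exp 7 t)).
  by apply: der_atanh; lra.
move=> t /andP[t0 ts].
have t2 : 1 / 2 <= 1 - t ^+ 2 by nra.
rewrite subr_ge0 ler_pdivrMr; last by lra.
have t6 : 0 <= t ^+ 6 by rewrite exprn_ge0// ltW.
by nra.
Qed.

Lemma coin_remainder_ge0 (s : R) : `|s| < 1 -> 0 <= coin_remainder s.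
Proof.
wlog s0 : s / 0 <= s.
  move=> wl; case: (lerP 0 s) => s0; first exact: wl.
  by rewrite -coin_remainderN -normrN; apply: wl; lra.
rewrite ger0_norm// => s1.
have <- : coin_remainder 0 = 0.
  by rewrite /coin_remainder /coin_rate addr0 !subr0 ln1 !expr0n /=; lra.
apply: (der_ge0_le s0 (f' := atanh)) => t /andP[? ?].
  by apply: der_coin_remainder; lra.
by apply: (proj1 (atanh_bounds _)); lra.
Qed.

Lemma coin_remainder_le (s : R) : `|s| <= 1 / 2 ->
  coin_remainder s <= s ^+ 8 / 28.
Proof.
wlog s0 : s / 0 <= s.
  move=> wl; case: (lerP 0 s) => s0; first exact: wl.
  rewrite -coin_remainderN -normrN -[s ^+ 8](_ : (- s) ^+ 8 = _); last by ring.
  by apply: wl; lra.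
rewrite ger0_norm// => s1; rewrite -subr_ge0.
have -> : 0 = 28^-1 * 0 ^+ 8 - coin_remainder 0.
  by rewrite /coin_remainder /coin_rate addr0 !subr0 ln1 !expr0n /=; lra.
rewrite [s ^+ 8 / 28]mulrC.
apply: (der_ge0_le s0 (f := fun s => 28^-1 * s ^+ 8 - coin_remainder s)
  (f' := fun s => 28^-1 * (8 * s ^+ 7) - atanh s)) => t /andP[? ?].
  apply: isder_sub; first exact: (isder_scale 28^-1 (isder_exp 8 t)).
  by apply: der_coin_remainder; lra.
have [|_ /(_ _)] := @atanh_bounds t; first by lra.
by move=> /(_ ltac:(lra)); lra.
Qed.

(** At [s = 1] and [s = - 1], where derivatives are not available, this is the
    numerical inequality [37/60 <= ln 2]. *)
Lemma coin_rate_lower (s : R) : `|s| <= 1 ->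
  s ^+ 2 / 2 + s ^+ 4 / 12 + s ^+ 6 / 30 <= coin_rate s.
Proof.
rewrite le_eqVlt => /predU1P[|/coin_remainder_ge0]; last first.
  by rewrite /coin_remainder; lra.
have ln2 : 24 / 35 <= ln (2 : R).
  have -> : (2 : R) = (1 + 1 / 2) * (1 + 1 / 3) by field.
  rewrite lnM ?posrE; try lra.
  have a : 2 * (1 / 2) / (2 + 1 / 2) = 2 / 5 :> R by field.
  have b : 2 * (1 / 3) / (2 + 1 / 3) = 2 / 7 :> R by field.
  have := @ln1D_lower (1 / 2) ltac:(lra); have := @ln1D_lower (1 / 3) ltac:(lra).
  by rewrite a b; lra.
have e1 : coin_rate 1 = ln 2.
  by rewrite /coin_rate subrr mul0r addr0 mulrC mulKf.
have eN1 : coin_rate (-1) = ln 2.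
  by rewrite /coin_rate opprK subrr mul0r add0r mulrC mulKf.
move=> /eqP; rewrite eqr_norml => /andP[/orP[] /eqP -> _].
  by rewrite e1 !expr1n; lra.
by rewrite eN1; lra.
Qed.

End log_bounds.

(** * Stirling's formula and binomial coefficients *)

Section stirling.
Context {R : realType}.

(** The logarithm of the ratio of [n!] to [n^(n + 1/2) e^(-n)]. *)
Definition stirling_log (n : nat) : R :=
  ln n`!%:R - (n%:R + 1 / 2) * ln n%:R + n%:R.

(** The difference is [(n + 1/2) ln (1 + 1/n) - 1], whence the two bounds on
    the logarithm. *)
Lemma stirling_log_step n : (0 < n)%N ->
  0 <= stirling_log n - stirling_log n.+1
    <= n%:R^-1 / 4 - n.+1%:R^-1 / 4.
Proof.
move=> n0; have nR : 0 < n%:R :> R by rewrite ltr0n.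
have SE : n.+1%:R = n%:R + 1 :> R by rewrite -addn1 natrD.
have z0 : 0 <= (n%:R^-1 : R) by rewrite invr_ge0 ltW.
have lnS : ln (n.+1%:R : R) = ln n%:R + ln (1 + n%:R^-1).
  have p : 0 < 1 + (n%:R^-1 : R) by lra.
  rewrite -lnM ?posrE//.
  by congr ln; rewrite SE; field; rewrite gt_eqF.
have -> : stirling_log n - stirling_log n.+1
    = (n%:R + 1 / 2) * ln (1 + n%:R^-1) - 1.
  rewrite /stirling_log factS natrM lnM ?posrE ?ltr0n ?fact_gt0//.
  by rewrite lnS SE; ring.
have c0 : 0 <= n%:R + 1 / 2 :> R by lra.
have lo : (n%:R + 1 / 2) * (2 * n%:R^-1 / (2 + n%:R^-1)) = 1 :> R.
  by field; rewrite !gt_eqF//; lra.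
have up : (n%:R + 1 / 2) * (n%:R^-1 * (2 + n%:R^-1) / (2 * (1 + n%:R^-1)))
    = 1 + (n%:R^-1 / 4 - n.+1%:R^-1 / 4) :> R.
  by rewrite SE; field; rewrite !gt_eqF//; lra.
have := ler_wpM2l c0 (ln1D_lower z0); have := ler_wpM2l c0 (ln1D_upper z0).
rewrite lo up => h1 h2; apply/andP; split; first by rewrite subr_ge0.
by rewrite lerBlDl.
Qed.

(** The sequence decreases while its difference with [1 / (4 n)] increases, by
    the telescoping bounds of [stirling_log_step]; its limit is
    [ln (sqrt (2 pi))]. *)
Lemma stirling_log_limit : exists l : R, forall n, (0 < n)%N ->
  l <= stirling_log n <= l + n%:R^-1 / 4.
Proof.
have decr n d : (0 < n)%N -> stirling_log (n + d) <= stirling_log n.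
  move=> n0; elim: d => [|d IH]; first by rewrite addn0.
  have /stirling_log_step : (0 < n + d)%N by rewrite addn_gt0 n0.
  by rewrite addnS; move: IH; lra.
have incr n d : (0 < n)%N ->
    stirling_log n - n%:R^-1 / 4 <= stirling_log (n + d) - (n + d)%N%:R^-1 / 4.
  move=> n0; elim: d => [|d IH]; first by rewrite addn0.
  have /stirling_log_step : (0 < n + d)%N by rewrite addn_gt0 n0.
  rewrite addnS; move: IH.
  by move: (n + d)%N => m; move: (m%:R^-1 : R) (m.+1%:R^-1 : R) => u v; lra.
have inv0 n : 0 <= (n%:R^-1 / 4 : R) by rewrite divr_ge0// invr_ge0.
pose S : set R := [set stirling_log n | n in [set n | (0 < n)%N]].
have S0 : S !=set0 by exists (stirling_log 1); exists 1%N.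
have lbS n : (0 < n)%N -> lbound S (stirling_log n - n%:R^-1 / 4).
  move=> n0 _ [m /= m0 <-]; have [nm|mn] := leqP n m.
    by have := incr n (m - n)%N n0; rewrite subnKC//; have := inv0 m; lra.
  have := decr m (n - m)%N m0; rewrite subnKC 1?ltnW//.
  by have := inv0 n; lra.
exists (inf S) => n n0; apply/andP; split.
  by apply: ge_inf; [exists (stirling_log 1 - 1%:R^-1 / 4); exact: lbS|exists n].
by rewrite -lerBlDr; apply: lb_le_inf => //; exact: lbS.
Qed.

Section binomial.
Variables (N k : nat).
Let s : R := 1 - 2 * k%:R / N%:R.

Lemma ln_bin : (0 < k < N)%N ->
  ln 'C(N, k)%:R = stirling_log N - stirling_log k - stirling_log (N - k)
    + N%:R * (ln 2 - coin_rate s) + ln 2 - ln N%:R / 2 - ln (1 - s ^+ 2) / 2.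
Proof.
move=> /andP[k0 kN]; have kN' := ltnW kN.
have N0 : (0 < N)%N by exact: leq_trans kN.
have NR : 0 < N%:R :> R by rewrite ltr0n.
have kR : 0 < k%:R :> R by rewrite ltr0n.
have jR : 0 < (N - k)%:R :> R by rewrite ltr0n subn_gt0.
have jE : (N - k)%:R = N%:R - k%:R :> R by rewrite natrB.
have f0 n : (0 < n`!%:R :> R) by rewrite ltr0n fact_gt0.
have -> : ln ('C(N, k)%:R : R) = ln N`!%:R - ln k`!%:R - ln (N - k)`!%:R.
  rewrite -(bin_fact kN') !natrM !lnM ?posrE ?mulr_gt0//; last first.
    by rewrite ltr0n bin_gt0.
  by ring.
have sm : 1 - s = 2 * (k%:R / N%:R) by rewrite /s; ring.
have sp : 1 + s = 2 * ((N - k)%:R / N%:R).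
  by rewrite /s jE; field; rewrite gt_eqF.
have lm : ln (1 - s) = ln 2 + ln k%:R - ln N%:R.
  by rewrite sm lnM ?posrE ?divr_gt0// ln_div ?posrE// addrA.
have lp : ln (1 + s) = ln 2 + ln (N - k)%:R - ln N%:R.
  by rewrite sp lnM ?posrE ?divr_gt0// ln_div ?posrE// addrA.
have -> : ln (1 - s ^+ 2) = ln (1 - s) + ln (1 + s).
  have m0 : 0 < 1 - s by rewrite sm mulr_gt0// divr_gt0.
  have p0 : 0 < 1 + s by rewrite sp mulr_gt0// divr_gt0.
  by rewrite -lnM ?posrE//; congr ln; ring.
rewrite /coin_rate lm lp sm sp /stirling_log jE.
by field; rewrite gt_eqF.
Qed.

(** The term of index [k] in the binomial expansion of [1 = (b + a)^N], where
    [a = k / N] and [b = 1 - a], is at most 1. *)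
Lemma bin_le_coin_rate : (k <= N)%N -> (0 < N)%N ->
  'C(N, k)%:R <= 2 ^+ N * expR (- (N%:R * coin_rate s)).
Proof.
move=> kN N0; have NR : 0 < N%:R :> R by rewrite ltr0n.
have jE : (N - k)%:R = N%:R - k%:R :> R by rewrite natrB.
pose a : R := k%:R / N%:R; pose b : R := (N - k)%:R / N%:R.
have a0 : 0 <= a by rewrite divr_ge0.
have b0 : 0 <= b by rewrite divr_ge0.
have ab : b + a = 1 by rewrite /a /b jE; field; rewrite gt_eqF.
have C1 : 'C(N, k)%:R * (b ^+ (N - k) * a ^+ k) <= 1.
  apply: (@le_trans _ _ ((b + a) ^+ N)); last by rewrite ab expr1n.
  rewrite mulr_natl exprDn (bigD1 (inord k)) //= inordK// lerDl.
  by apply: sumr_ge0 => i _; rewrite mulrn_wge0// mulr_ge0// exprn_ge0.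
have sm : 1 - s = 2 * a by rewrite /s /a; ring.
have sp : 1 + s = 2 * b by rewrite /s /b jE; field; rewrite gt_eqF.
(* With [0 ln 0 = 0] and [0 ^ 0 = 1] both sides agree at the endpoints too. *)
have powE c n : 0 <= c -> (c = 0 -> n = 0%N) ->
    expR (n%:R * ln (2 * c)) = (2 * c) ^+ n.
  rewrite le_eqVlt => /predU1P[<- /(_ erefl) ->|c0 _].
    by rewrite mul0r expR0 expr0.
  by rewrite expRM_natl lnK// posrE mulr_gt0.
have wE : expR (N%:R * coin_rate s) = 2 ^+ N * (b ^+ (N - k) * a ^+ k).
  rewrite /coin_rate sm sp.
  have -> : N%:R * ((2 * b * ln (2 * b) + 2 * a * ln (2 * a)) / 2)
      = (N - k)%:R * ln (2 * b) + k%:R * ln (2 * a).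
    by rewrite [in RHS](_ : k%:R = N%:R * a) ?[in RHS](_ : (N - k)%:R = N%:R * b);
      rewrite /a /b; field; rewrite gt_eqF.
  rewrite expRD !powE//.
  - have -> : (2 ^+ N : R) = 2 ^+ (N - k) * 2 ^+ k by rewrite -exprD subnK.
    by rewrite !exprMn; ring.
  - by rewrite /a => /eqP; rewrite mulf_eq0 invr_eq0 (gt_eqF NR) orbF pnatr_eq0 => /eqP.
  - by rewrite /b => /eqP; rewrite mulf_eq0 invr_eq0 (gt_eqF NR) orbF pnatr_eq0 => /eqP.
rewrite expRN ler_pdivlMr ?expR_gt0// wE mulrCA.
by rewrite ler_piMr// exprn_ge0.
Qed.

End binomial.
End stirling.

(** * Riemann sums, and expectations under a density *)

Section step_sums.
Context {R : realType}.
Local Notation mu := (@lebesgue_measure R).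
Variables (M : nat -> nat) (c delta : nat -> R) (v : nat -> nat -> R).
Hypothesis delta_gt0 : forall n, 0 < delta n.

(** The cells are indexed from right to left, as the points of the grid decrease
    when [k] grows; each contains its right end, the grid point of index [k]. *)
Definition cell n k : set R :=
  `](c n - k.+1%:R) * delta n, (c n - k%:R) * delta n]%classic.

Definition step_fun n (x : R) : R := \sum_(k < M n) v n k * \1_(cell n k) x.

Lemma cell_uniq n k l x : cell n k x -> cell n l x -> k = l.
Proof.
have key i j : cell n i x -> cell n j x -> (i <= j)%N.
  rewrite /cell /= !in_itv/= => /andP[_ i2] /andP[j1 _].
  have := lt_le_trans j1 i2; rewrite ltr_pM2r// ltrD2l ltrN2 ltr_nat.
  by rewrite ltnS.
by move=> ck cl; apply/eqP; rewrite eqn_leq !key.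
Qed.

Lemma step_funE n k x : (k < M n)%N -> cell n k x -> step_fun n x = v n k.
Proof.
move=> kM ck; rewrite /step_fun (bigD1 (Ordinal kM))//= indicE mem_set// mulr1.
rewrite big1 ?addr0// => i ik; rewrite indicE memNset ?mulr0// => ci.
by move: ik; rewrite -val_eqE/= (cell_uniq ci ck) eqxx.
Qed.

Lemma step_fun_out n x : (forall k, (k < M n)%N -> ~ cell n k x) ->
  step_fun n x = 0.
Proof.
by move=> out; rewrite /step_fun big1// => i _; rewrite indicE memNset ?mulr0//;
  exact: out.
Qed.

Lemma lebesgue_cell n k : mu (cell n k) = (delta n)%:E.
Proof.
rewrite /cell lebesgue_measure_itv/= lte_fin.
rewrite ltr_pM2r// ltrD2l ltrN2 ltr_nat ltnSn -EFinB; congr EFin.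
by rewrite -[k.+1]addn1 natrD; ring.
Qed.

Lemma integral_step_fun n :
  (\int[mu]_x (step_fun n x)%:E = (delta n * \sum_(k < M n) v n k)%:E)%E.
Proof.
under eq_integral do rewrite /step_fun -sumEFin.
have icell (k : 'I_(M n)) :
    mu.-integrable setT (fun x => (v n k * \1_(cell n k) x)%:E).
  under eq_fun do rewrite EFinM.
  by apply: integrableZl => //; exact: integrable_indic_itv.
rewrite (integral_sum measurableT icell) mulr_sumr -sumEFin.
apply: eq_bigr => k _.
under eq_integral do rewrite EFinM.
rewrite integralZl//; last exact: integrable_indic_itv.
rewrite integral_indic ?setIT//; last exact: measurable_itv.
rewrite mulrC EFinM; congr (_ * _)%E; exact: lebesgue_cell.
Qed.

Lemma measurable_step_fun n : measurable_fun setT (step_fun n).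
Proof.
rewrite /step_fun; apply: measurable_sum => k.
by apply: measurable_funM => //; apply: measurable_indic; exact: measurable_itv.
Qed.

(** Weighted sums over a grid, seen as integrals of step functions on the whole
    line, converge by dominated convergence; this handles at once the
    variation of the weights with [n] and the tails. *)
Lemma riemann_sum_cvg (f g : R -> R) :
  mu.-integrable setT (EFin \o g) ->
  measurable_fun setT f ->
  (forall x, 0 <= g x) ->
  (forall n k x, (k < M n)%N -> cell n k x -> `|v n k| <= g x) ->
  (forall x, step_fun n x @[n --> \oo] --> f x) ->
  mu.-integrable setT (EFin \o f) /\
  delta n * \sum_(k < M n) v n k @[n --> \oo] --> (\int[mu]_x f x)%R.
Proof.
move=> ig mf g0 vg sf.
have [|||||] := @dominated_convergence _ _ R mu setT measurableT
  (fun n x => (step_fun n x)%:E) (EFin \o f) (EFin \o g).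
- by move=> n; apply/measurable_EFinP; exact: measurable_step_fun.
- exact/measurable_EFinP.
- by apply: aeW => x _; apply: cvg_EFin; [exact: nearW|exact: sf].
- exact: ig.
- apply: aeW => x n _ /=; rewrite lee_fin.
  have [[k [kM ck]]|out] := pselect (exists k, (k < M n)%N /\ cell n k x).
    by rewrite (step_funE kM ck); exact: vg ck.
  by rewrite step_fun_out ?normr0// => k kM ck; apply: out; exists k.
move=> fi _ /=; under eq_fun do rewrite integral_step_fun.
rewrite -(fineK (integrable_fin_num measurableT fi)) => /fine_cvg h.
by split.
Qed.

End step_sums.

Section density.
Context {R : realType} d (T : measurableType d) (P : probability T R)
  (F : {RV P >-> R}) (w : R -> R).
Local Notation mu := (@lebesgue_measure R).

(* The Lebesgue measure lives on [measurableTypeR R], which has the same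
   measurable sets as [R] but another display. *)
Let G : T -> measurableTypeR R := F.

Let mG : measurable_fun setT G.
Proof. by move=> _ A mA; exact: (measurable_funPT F). Qed.

#[local] HB.instance Definition _ := isMeasurableFun.Build _ _ _ _ G mG.

Let nu := distribution P (G : {RV P >-> measurableTypeR R}).

(** The density is the Radon-Nikodym derivative of the distribution, by almost
    sure uniqueness of the latter; hence the change of variables. *)
Lemma expectation_density (phi : R -> R) (B : R) :
  mu.-integrable setT (EFin \o w) ->
  (forall A : set R, measurable A ->
    distribution P F A = (\int[mu]_(x in A) (w x)%:E)%E) ->
  measurable_fun setT phi -> (forall x, `|phi x| <= B) ->
  ('E_P[phi \o F] = \int[mu]_x (phi x * w x)%:E)%E.
Proof.
move=> wi wF mphi phiB.
have numu : nu `<< mu.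
  apply/null_content_dominatesP => A mA A0; apply: (eq_trans (wF A mA)).
  by rewrite null_set_integral//; exact: measurable_funTS (measurable_int _ wi).
have mphi' : measurable_fun [set: measurableTypeR R] (EFin \o phi).
  exact/measurable_EFinP.
have bnd (A : Type) (H : A -> R) : [bounded phi (H x) | x in [set: A]].
  exists B; split; first exact: num_real.
  by move=> b Bb x _; exact: le_trans (phiB _) (ltW Bb).
have fin d0 (T0 : measurableType d0) (P0 : probability T0 R) :
    (P0 setT < +oo)%E.
  by rewrite (le_lt_trans (probability_le1 _ _))// ltry.
have iF : P.-integrable setT (EFin \o (phi \o F)).
  apply: measurable_bounded_integrable; [by []|exact: fin| |exact: bnd].
  exact: measurableT_comp.
have inu : nu.-integrable setT (EFin \o phi).
  apply: measurable_bounded_integrable; [by []|exact: fin| |exact: (bnd _ id)].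
  exact/measurable_EFinP.
have dom : charge_of_finite_measure nu `<< mu by [].
have iD := Radon_Nikodym_integrable dom.
rewrite unlock; transitivity (\int[nu]_x (phi x)%:E)%E.
  by rewrite integral_distribution.
rewrite -(Radon_Nikodym_change_of_variables numu measurableT inu).
apply: ae_eq_integral => //.
- apply: emeasurable_funM; first exact: mphi'.
  exact: (measurable_int _ iD).
- apply/measurable_EFinP; apply: measurable_funM; first exact/measurable_EFinP.
  by apply/measurable_EFinP; exact: (measurable_int _ wi).
under [X in ae_eq _ _ _ X]eq_fun do rewrite EFinM.
apply: ae_eqe_mul2l.
apply: (integral_ae_eq measurableT iD (measurable_int _ wi)) => E _ mE.
by rewrite -(Radon_Nikodym_integral dom mE); exact: wF.
Qed.

End density.

(** * Expectations under the Potts measure *)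

Section configurations.
Context {R : realType} (q : nat) (hq : (1 < q)%N) (p : nat) (beta h : R)
  (N : nat).

Lemma potts_set1 (x : config hq N) : potts p beta h [set x]
  = (potts_weight p beta h x / potts_partition hq p beta h N)%:E.
Proof.
rewrite /potts esum_set1// lee_fin divr_ge0 ?expR_ge0//.
by rewrite /potts_partition sumr_ge0// => y _; exact: expR_ge0.
Qed.

Lemma expectation_potts d (T : measurableType d) (P : probability T R)
    (X : {RV P >-> config hq N}) (phi : config hq N -> R) :
  (forall A : set (config hq N), distribution P X A = potts p beta h A) ->
  ('E_P[phi \o X] = ((\sum_x phi x * potts_weight p beta h x)
                     / potts_partition hq p beta h N)%R%:E)%E.
Proof.
move=> hX; pose F x := X @^-1` [set x].
have mF x : measurable (F x) by rewrite /F; apply: measurable_funPTI.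
have iF x : P.-integrable setT (fun t => (phi x * \1_(F x) t)%:E).
  under eq_fun do rewrite EFinM.
  by apply: integrableZl => //; exact: integrable_indic.
have -> : phi \o X = fun t => \sum_x phi x * \1_(F x) t.
  apply/funext => t /=; rewrite (bigD1 (X t))//= indicE mem_set// mulr1.
  rewrite big1 ?addr0// => x xX; rewrite indicE memNset ?mulr0//.
  by move=> /= e; move: xX; rewrite e eqxx.
rewrite unlock; under eq_integral do rewrite -sumEFin.
rewrite (integral_sum measurableT iF) mulr_suml -sumEFin.
apply: eq_bigr => x _.
under eq_integral do rewrite EFinM.
rewrite integralZl//; last exact: integrable_indic.
rewrite integral_indic// setIT -mulrA EFinM; congr (_ * _)%E.
by rewrite -potts_set1 -hX.
Qed.

End configurations.

Section two_colors.
Context {R : realType} (hq : (1 < 2)%N) (N : nat).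
Local Notation c1 := (color1 hq).

Definition count1 (x : {ffun 'I_N -> 'I_2}) : nat := #|[set i | x i == c1]%SET|.

Lemma color1_ord_max : ord_max != c1.
Proof. by []. Qed.

Lemma color_cases (r : 'I_2) : r = c1 \/ r = ord_max.
Proof. by case: r => -[|[|//]] i; [left|right]; exact: val_inj. Qed.

(** A configuration with two colours is the set of the sites of the first
    one. *)
Lemma sum_config (G : nat -> R) :
  \sum_(x : config hq N) G (count1 x) = \sum_(k < N.+1) 'C(N, k)%:R * G k.
Proof.
pose f (A : {set 'I_N}) : config hq N := [ffun i => if i \in A then c1 else ord_max].
have fA A : [set i | f A i == c1]%SET = A.
  by apply/setP => i; rewrite inE ffunE; case: (i \in A).
have fx (x : config hq N) : f [set i | x i == c1]%SET = x.
  apply/ffunP => i; rewrite ffunE inE; case: eqP => [->//|xi].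
  by case: (color_cases (x i)).
rewrite (reindex_onto f (fun x : config hq N => [set i | x i == c1]%SET)); last first.
  by move=> x _; exact: fx.
rewrite (eq_bigl predT); last by move=> A; rewrite /= fA eqxx.
under eq_bigr do rewrite /count1 fA.
have card_lt (A : {set 'I_N}) : (#|A| < N.+1)%N.
  by rewrite ltnS -[X in (_ <= X)%N](card_ord N) max_card.
rewrite (partition_big (fun A : {set 'I_N} => Ordinal (card_lt A)) predT)//=.
apply: eq_bigr => k _.
under eq_bigl do rewrite -val_eqE /=.
rewrite (eq_bigr (fun=> G k)); last by move=> A /eqP ->.
have := card_draws 'I_N k; rewrite card_ord => <-.
by rewrite sumr_const mulr_natl; congr (_ *+ _); apply: eq_card => A; rewrite inE.
Qed.

Lemma count1_other (x : {ffun 'I_N -> 'I_2}) :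
  #|[set i | x i == ord_max]%SET| = (N - count1 x)%N.
Proof.
have := cardsC [set i | x i == c1]%SET.
rewrite card_ord => cN; transitivity #|~: [set i | x i == c1]%SET|; last first.
  by rewrite -[X in (X - _)%N]cN addKn.
apply: eq_card => i.
by rewrite !inE; case: (color_cases (x i)) => ->.
Qed.

Lemma empirical_two_colors (x : {ffun 'I_N -> 'I_2}) : (0 < N)%N ->
  empirical x c1 0 = (count1 x)%:R / N%:R :> R /\
  empirical x ord_max 0 = 1 - (count1 x)%:R / N%:R :> R.
Proof.
move=> N0; have NR : N%:R != 0 :> R by rewrite pnatr_eq0 -lt0n.
have cardE r : #|[set i | x i == r]| = #|[set i | x i == r]%SET|.
  by apply: eq_card => i; rewrite !inE; apply/idP/idP; rewrite inE.
split; rewrite mxE cardE// count1_other natrB; first by field.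
by rewrite -[X in (_ <= X)%N](card_ord N) max_card.
Qed.

End two_colors.

(** * The scaled weights *)

Section asymptotics.
Context {R : realType} (b hbar : R).

(** The number of sites is [n.+1], so that it is never 0; it is the sixth power
    of [root6 n]. *)
Definition sites (n : nat) : R := n.+1%:R.
Definition root6 (n : nat) : R := sites n `^ (1 / 6).
Definition mesh (n : nat) : R := (root6 n ^+ 5)^-1.

Lemma sites_gt0 n : 0 < sites n. Proof. exact: ltr0Sn. Qed.

Lemma root6_ge1 n : 1 <= root6 n.
Proof.
apply: (@le_trans _ _ (1 `^ (1 / 6))); first by rewrite powR1.
apply: ge0_ler_powR.
- by rewrite divr_ge0.
- by rewrite nnegrE.
- by rewrite nnegrE ltW// sites_gt0.
- by rewrite /sites ler1n.
Qed.

Lemma root6_gt0 n : 0 < root6 n.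
Proof. exact: lt_le_trans (root6_ge1 n). Qed.

Lemma root6X n : root6 n ^+ 6 = sites n.
Proof.
rewrite /root6 -powR_mulrn ?powR_ge0// -powRrM.
by rewrite div1r mulVf// powRr1// ltW// sites_gt0.
Qed.

Lemma sites_powN56 n : sites n `^ (- (5 / 6)) = mesh n.
Proof.
rewrite /mesh /root6 -powR_mulrn ?powR_ge0// -powRrM powRN.
by congr (_ `^ _)^-1; field.
Qed.

Lemma mesh_gt0 n : 0 < mesh n.
Proof. by rewrite invr_gt0 exprn_gt0// root6_gt0. Qed.

Lemma mesh_le1 n : mesh n <= 1.
Proof. by rewrite invf_le1 ?exprn_gt0 ?root6_gt0// exprn_ege1// root6_ge1. Qed.

Lemma root6_cvg : root6 n @[n --> \oo] --> +oo.
Proof.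
apply/cvgryPge => A; near=> n.
have : A ^+ 6 <= sites n.
  rewrite /sites; apply: (@le_trans _ _ n%:R); last by rewrite ler_nat.
  by near: n; exact: nbhs_infty_ger.
rewrite -root6X => h; rewrite leNgt; apply/negP => rA.
have : root6 n ^+ 6 < A ^+ 6.
  by rewrite ltrXn2r// ?ltW ?root6_gt0.
by rewrite ltNge h.
Unshelve. all: by end_near. Qed.

Lemma root6V_cvg0 : (root6 n)^-1 @[n --> \oo] --> 0.
Proof.
by apply/gtr0_cvgV0; [exact: nearW root6_gt0|exact: root6_cvg].
Qed.

Lemma cvg_exprn (u : nat -> R) (a : R) m :
  u n @[n --> \oo] --> a -> u n ^+ m @[n --> \oo] --> a ^+ m.
Proof. by move=> ua; exact: (cvg_comp _ _ ua (@exprn_continuous R m a)). Qed.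

Lemma mesh_cvg0 : mesh n @[n --> \oo] --> 0.
Proof.
have -> : mesh = fun n => (root6 n)^-1 ^+ 5 by apply/funext => n; rewrite exprVn.
have -> : 0 = 0 ^+ 5 :> R by rewrite expr0n.
exact: cvg_exprn root6V_cvg0.
Qed.

(** The scaled fluctuation when [k] of the [N] sites have the first colour:
    [N^(1/6) (1/2 - k/N)]. *)
Definition grid_point (n k : nat) : R := (sites n / 2 - k%:R) * mesh n.
(** The parameter [1 - 2k/N] of the magnetization, the argument of the rate
    function. *)
Definition slope (n k : nat) : R := 2 * grid_point n k / root6 n.

Lemma slopeE n k : slope n k = 1 - 2 * k%:R / n.+1%:R.
Proof.
rewrite -[n.+1%:R]/(sites n) -root6X /slope /grid_point /mesh -root6X.
by field; rewrite gt_eqF// root6_gt0.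
Qed.

Lemma slope_le1 n k : (k <= n.+1)%N -> `|slope n k : R| <= 1.
Proof.
move=> kn; rewrite slopeE ler_norml -mulrA.
have : 0 <= k%:R / n.+1%:R :> R by rewrite divr_ge0.
have : k%:R / n.+1%:R <= 1 :> R by rewrite ler_pdivrMr// mul1r ler_nat.
by move: (k%:R / n.+1%:R) => t; lra.
Qed.

(** The exponent of the Potts weight up to the constant [tilt_const]: the terms
    of the energy at the special point that the entropy cancels, then the
    perturbations of the inverse temperature and of the field. *)
Definition tilt (n k : nat) : R :=
  sites n * (slope n k ^+ 2 / 2 + slope n k ^+ 4 / 12)
  + root6 n * b * (6 * slope n k ^+ 2 + slope n k ^+ 4) / 8
  - hbar * grid_point n k.

(** The weight of the configurations with [k] coordinates of the first colour,
    scaled so as to have a limit. *)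
Definition psi (n k : nat) : R :=
  root6 n ^+ 3 / 2 ^+ n.+1 * 'C(n.+1, k)%:R * expR (tilt n k).

Definition tilt_const (n : nat) : R :=
  sites n / 12 + root6 n * b / 8 + root6 n * hbar / 2.

Lemma tiltE n k (t := k%:R / n.+1%:R : R) :
  (2 / 3 + mesh n * b) * sites n * (t ^+ 4 + (1 - t) ^+ 4)
  + sites n * (mesh n * hbar) * t = tilt_const n + tilt n k.
Proof.
have r0 : root6 n != 0 by rewrite gt_eqF// root6_gt0.
have tE : t = (1 - slope n k) / 2 by rewrite slopeE /t; field.
have xE : grid_point n k = root6 n * slope n k / 2 by rewrite /slope; field.
rewrite tE /tilt /tilt_const xE; move: (slope n k) => s.
by rewrite /mesh -root6X; field.
Qed.

Lemma psi_gt0 n k : (k <= n.+1)%N -> 0 < psi n k.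
Proof.
move=> kn; rewrite /psi mulr_gt0 ?expR_gt0//.
rewrite mulr_gt0 ?ltr0n ?bin_gt0// divr_gt0 ?exprn_gt0 ?root6_gt0//.
Qed.

(** Valid for all [k] but with a prefactor [root6 n ^+ 3] that is of the right
    order only at the edges of the grid. *)
Lemma psi_crude n k : (k <= n.+1)%N -> psi n k <= root6 n ^+ 3 *
  expR (- (32 / 15) * grid_point n k ^+ 6
    + root6 n * b * (6 * slope n k ^+ 2 + slope n k ^+ 4) / 8
    - hbar * grid_point n k).
Proof.
move=> kn; have r0 := root6_gt0 n.
have binle := @bin_le_coin_rate R n.+1 k kn isT; rewrite -slopeE in binle.
have s1 := slope_le1 kn.
have low := ler_wpM2l (ltW (sites_gt0 n)) (coin_rate_lower s1).
have -> : psi n k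
    = root6 n ^+ 3 * ((2 ^+ n.+1)^-1 * ('C(n.+1, k)%:R * expR (tilt n k))).
  by rewrite /psi !mulrA.
rewrite ler_pM2l ?exprn_gt0// ler_pdivrMl ?exprn_gt0//.
apply: le_trans (ler_wpM2r (expR_ge0 _) binle) _.
rewrite -[leLHS]mulrA ler_pM2l ?exprn_gt0// -expRD ler_expR /tilt.
have xE : sites n * (slope n k ^+ 6 / 30) = 32 / 15 * grid_point n k ^+ 6.
  by rewrite -root6X /slope; field; rewrite gt_eqF.
by move: low; rewrite !mulrDr xE -[n.+1%:R]/(sites n); lra.
Qed.

Variable l : R.
Hypothesis hl : forall n, (0 < n)%N ->
  l <= stirling_log n <= l + n%:R^-1 / 4.

Definition log_psi (n k : nat) : R :=
  ln 2 + (stirling_log n.+1 - stirling_log k - stirling_log (n.+1 - k))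
  - ln (1 - slope n k ^+ 2) / 2 - 32 / 15 * grid_point n k ^+ 6
  - sites n * coin_remainder (slope n k)
  + root6 n * b * (6 * slope n k ^+ 2 + slope n k ^+ 4) / 8
  - hbar * grid_point n k.

(** Stirling's formula turns the scaled weight into an exponential in which the
    powers of [N] have cancelled. *)
Lemma psiE n k : (0 < k < n.+1)%N -> psi n k = expR (log_psi n k).
Proof.
move=> kn; have r0 := root6_gt0 n.
have C0 : 0 < 'C(n.+1, k)%:R :> R.
  by rewrite ltr0n bin_gt0; case/andP: kn => _ /ltnW.
have lnE := @ln_bin R n.+1 k kn; rewrite -slopeE in lnE.
have rE : root6 n ^+ 3 = expR (ln (n.+1%:R) / 2).
  rewrite -[n.+1%:R]/(sites n) -root6X lnXn//.
  have -> : ln (root6 n) *+ 6 / 2 = 3%:R * ln (root6 n) by rewrite -mulr_natr; field.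
  by rewrite expRM_natl lnK.
have pE : (2 ^+ n.+1)^-1 = expR (- (n.+1%:R * ln 2)) :> R.
  by rewrite expRN expRM_natl lnK ?posrE.
rewrite /psi rE pE -[X in _ * X * _](lnK (C0 : _ \is Num.pos)) lnE -!expRD.
congr expR; rewrite /log_psi /tilt /coin_remainder.
have xE : 32 / 15 * grid_point n k ^+ 6 = sites n * (slope n k ^+ 6 / 30).
  by rewrite -root6X /slope; field; rewrite gt_eqF.
by rewrite xE -[n.+1%:R]/(sites n); ring.
Qed.

End asymptotics.

(** * Uniform bound and limit of the scaled weights *)

Section limits.
Context {R : realType} (b hbar l : R).
Hypothesis hl : forall n, (0 < n)%N ->
  l <= stirling_log n <= l + n%:R^-1 / 4.
Local Notation psi := (psi b hbar).
Local Notation log_psi := (log_psi b hbar).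

Definition perturbation_bound (x : R) : R :=
  7 / 2 * `|b| * x ^+ 2 + `|hbar| * `|x|.

Lemma perturbation_le n k : (k <= n.+1)%N ->
  root6 n * b * (6 * slope n k ^+ 2 + slope n k ^+ 4) / 8
    - hbar * grid_point n k
  <= perturbation_bound (grid_point n k).
Proof.
move=> kn; have r0 : 0 < root6 n :> R by exact: root6_gt0.
have r1 : 1 <= root6 n :> R by exact: root6_ge1.
have s1 : `|slope n k : R| <= 1 by exact: slope_le1.
rewrite /perturbation_bound; apply: lerD; last first.
  by rewrite -mulNr (le_trans (ler_norm _))// normrM normrN.
have -> : root6 n * b * (6 * slope n k ^+ 2 + slope n k ^+ 4) / 8
    = b * (root6 n * (6 * slope n k ^+ 2 + slope n k ^+ 4) / 8) by ring.
rewrite [leRHS](_ : _ = `|b| * (7 / 2 * grid_point n k ^+ 2)); last by ring.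
apply: (@le_trans _ _ (`|b| * (root6 n * (6 * slope n k ^+ 2 + slope n k ^+ 4) / 8))).
  apply: ler_wpM2r; last exact: ler_norm.
  have s0 m : 0 <= slope n k ^+ m.*2 :> R by rewrite exprn_even_ge0// odd_double.
  have := s0 1%N; have := s0 2%N; rewrite /= => s4 s2.
  by rewrite divr_ge0//; apply: mulr_ge0; [exact: ltW|lra].
apply: ler_wpM2l => //.
have s4 : slope n k ^+ 4 <= slope n k ^+ 2 :> R.
  have s2 : slope n k ^+ 2 <= 1 :> R.
    by rewrite -real_normK ?num_real// exprn_ile1.
  by have := sqr_ge0 (slope n k : R); nra.
have -> : grid_point n k = root6 n * slope n k / 2 :> R.
  by rewrite /slope; field; rewrite gt_eqF.
rewrite [leRHS](_ : _ = root6 n * (7 * (root6 n * slope n k ^+ 2)) / 8); last first.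
  by field.
rewrite ler_pM2r// ler_pM2l//.
have s2 : slope n k ^+ 2 <= root6 n * slope n k ^+ 2 :> R.
  by rewrite ler_peMl// sqr_ge0.
by lra.
Qed.

Definition psi_const : R := `|ln 2 - l + 1 / 4 - ln (3 / 4) / 2|.

(** For [|slope| < 1/2] this is Stirling's formula.  Otherwise
    [|grid_point| >= root6 / 4], so that the prefactor of the crude bound obeys
    [root6^3 <= exp (3 root6) <= exp (12 |grid_point|)]. *)
Lemma psi_le n k : (k <= n.+1)%N -> psi n k <=
  expR (psi_const + 12 * `|grid_point n k| - 32 / 15 * grid_point n k ^+ 6
        + perturbation_bound (grid_point n k)).
Proof.
move=> kn; have r0 : 0 < root6 n :> R by exact: root6_gt0.
have pert := perturbation_le kn.
have xE : grid_point n k = root6 n * slope n k / 2 :> R.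
  by rewrite /slope; field; rewrite gt_eqF.
have c0 : 0 <= psi_const by rewrite normr_ge0.
have [s2|s2] := lerP (1 / 2) `|slope n k : R|.
  apply: le_trans (psi_crude b hbar kn) _.
  have r3 : root6 n ^+ 3 <= expR (12 * `|grid_point n k : R|).
    apply: (@le_trans _ _ (expR (root6 n) ^+ 3)).
      rewrite lerXn2r ?nnegrE ?expR_ge0 ?ltW//.
      by have := expR_ge1Dx (root6 n : R); lra.
    have xN : `|grid_point n k : R| = root6 n * `|slope n k : R| / 2.
      by rewrite xE 2!normrM (gtr0_norm r0) [X in _ * X = _]ger0_norm.
    rewrite -expRM_natl ler_expR xN.
    by have := ler_wpM2l (ltW r0) s2; lra.
  apply: (@le_trans _ _ (expR (12 * `|grid_point n k : R|) *
    expR (- (32 / 15) * grid_point n k ^+ 6 + perturbation_bound (grid_point n k)))).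
    apply: ler_pM r3 _; [by rewrite exprn_ge0// ltW|exact: expR_ge0|].
    by rewrite ler_expR; move: pert; lra.
  by rewrite -expRD ler_expR; lra.
have k0 : (0 < k)%N.
  rewrite lt0n; apply/negP => /eqP k0; move: s2.
  by rewrite slopeE k0 mulr0 mul0r subr0 normr1; lra.
have kn' : (k < n.+1)%N.
  rewrite ltn_neqAle kn andbT; apply/negP => /eqP kE; move: s2.
  rewrite slopeE kE mulfK// [1 - 2](_ : _ = -1); last by lra.
  by rewrite normrN1; lra.
rewrite psiE ?k0// ler_expR /log_psi.
have sl0 : stirling_log n.+1 <= l + 1 / 4.
  have /andP[_ le] := hl (ltn0Sn n); apply: le_trans le _.
  by rewrite lerD2l ler_pM2r// invf_le1// ler1n.
have sl1 : l <= stirling_log k by case/andP: (hl k0).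
have sl2 : l <= stirling_log (n.+1 - k).
  have nk : (0 < n.+1 - k)%N by rewrite subn_gt0.
  by case/andP: (hl nk).
have ss : slope n k ^+ 2 <= 1 / 4 :> R.
  rewrite -real_normK ?num_real//; have := normr_ge0 (slope n k : R); nra.
have lnss : ln (3 / 4) <= ln (1 - slope n k ^+ 2) :> R.
  by rewrite ler_ln ?posrE; lra.
have rem0 : 0 <= sites n * coin_remainder (slope n k) :> R.
  apply: mulr_ge0; first exact/ltW/sites_gt0.
  by apply: coin_remainder_ge0; lra.
have cge : ln 2 - l + 1 / 4 - ln (3 / 4) / 2 <= psi_const by exact: ler_norm.
have x0 := normr_ge0 (grid_point n k : R).
move: pert sl0 sl1 sl2 lnss rem0 cge x0.
move: (stirling_log n.+1) (stirling_log k) (stirling_log (n.+1 - k)).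
by move: (sites n * _) => u v w z; lra.
Qed.

Lemma cubic_bound (a t : R) : 0 <= a -> 0 <= t -> a * t - t ^+ 3 <= a * (a + 1).
Proof.
move=> a0 t0; have [ta|ta] := lerP t (a + 1).
  have : 0 <= t ^+ 3 by rewrite exprn_ge0.
  by have := ler_wpM2l a0 ta; lra.
have t1 : 1 <= t by lra.
have : a * t <= t ^+ 3 by nra.
have : 0 <= a * (a + 1) by rewrite mulr_ge0//; lra.
by lra.
Qed.

(** The sixth power dominates all the other terms of [psi_le]. *)
Lemma psi_gauss : exists C : R, forall n k, (k <= n.+1)%N ->
  psi n k <= expR (C - 2 * grid_point n k ^+ 2).
Proof.
pose a : R := 12 + `|hbar| + 7 / 2 * `|b| + 2.
exists (psi_const + 12 + `|hbar| + a * (a + 1)) => n k kn.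
apply: le_trans (psi_le kn) _; rewrite ler_expR /perturbation_bound.
move: (grid_point n k) => x.
have a0 : 0 <= a by rewrite /a; have := normr_ge0 b; have := normr_ge0 hbar; lra.
have x2 : 0 <= x ^+ 2 by exact: sqr_ge0.
have := cubic_bound a0 x2; rewrite -exprM => cub.
have x6 : 0 <= x ^+ 6 by exact: exprn_even_ge0.
have x1 : `|x| <= 1 + x ^+ 2.
  rewrite -real_normK ?num_real//; have := normr_ge0 x; nra.
have h0 := normr_ge0 hbar; have hx := ler_wpM2l h0 x1.
move: cub; rewrite /a; lra.
Qed.

Definition limit_density (x : R) : R := expR (- (32 / 15) * x ^+ 6 - hbar * x).

(** Each term of [log_psi] has a limit: those from Stirling's formula sum up to
    [ln 2 - l], the remainder of the rate function and the perturbation by [b]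
    vanish, and the sixth power and the linear term in the grid point are
    continuous. *)
Lemma psi_cvg (k : nat -> nat) (x : R) :
  (\forall n \near \oo, (0 < k n < n.+1)%N) ->
  grid_point n (k n) @[n --> \oo] --> x ->
  psi n (k n) @[n --> \oo] --> 2 * expR (- l) * limit_density x.
Proof.
move=> kn yx.
have r0 n : 0 < root6 n :> R by exact: root6_gt0.
have s0 : slope n (k n) @[n --> \oo] --> (0 : R).
  rewrite [X in _ --> X](_ : 0 = 2 * x * 0); last by rewrite mulr0.
  by apply: cvgM; [apply: cvgM => //; exact: cvg_cst|exact: root6V_cvg0].
have sV : (sites n)^-1 @[n --> \oo] --> (0 : R).
  have -> : (fun n => (sites n)^-1) = fun n => (root6 n)^-1 ^+ 6 :> R.
    by apply/funext => n; rewrite exprVn root6X.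
  rewrite [X in _ --> X](_ : 0 = 0 ^+ 6); last by rewrite expr0n.
  exact/cvg_exprn/root6V_cvg0.
(* [stirling_log (m n) --> l] as soon as [m n] grows linearly with [n]. *)
have st (m : nat -> nat) (e : nat -> R) (c : R) :
    (\forall n \near \oo, (0 < m n)%N /\ (m n)%:R^-1 = (sites n)^-1 * e n) ->
    e n @[n --> \oo] --> c -> stirling_log (m n) @[n --> \oo] --> l.
  move=> me ec.
  apply: (@squeeze_cvgr _ _ _ _ (fun=> l) (fun n => l + (sites n)^-1 * e n / 4)).
  - near=> n.
    have [m0 <-] : (0 < m n)%N /\ (m n)%:R^-1 = (sites n)^-1 * e n.
      by near: n; exact: me.
    exact: hl.
  - exact: cvg_cst.
  - rewrite [X in _ --> X](_ : l = l + 0 * c / 4); last by lra.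
    apply: cvgD; first exact: cvg_cst.
    by apply: cvgM; [exact: cvgM|exact: cvg_cst].
have one_pm (c : R) : 1 + c * slope n (k n) @[n --> \oo] --> (1 : R).
  rewrite [X in _ --> X](_ : 1 = 1 + c * 0); last by rewrite mulr0 addr0.
  by apply: cvgD; [exact: cvg_cst|apply: cvgM => //; exact: cvg_cst].
have two_pm (c : R) : 2 / (1 + c * slope n (k n)) @[n --> \oo] --> (2 / 1 : R).
  by apply: cvgM; [exact: cvg_cst|apply: cvgV; [exact: oner_neq0|exact: one_pm]].
have stN : stirling_log n.+1 @[n --> \oo] --> l.
  apply: (st _ (fun=> 1) 1); last exact: cvg_cst.
  by apply: nearW => n; rewrite mulr1.
have stk : stirling_log (k n) @[n --> \oo] --> l.
  apply: (st _ _ _ _ (two_pm (-1))); apply: (filterS _ kn) => n /andP[k0 kN].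
  have NR : 0 < sites n :> R := sites_gt0 n; have kR : 0 < (k n)%:R :> R by rewrite ltr0n.
  split=> //; have -> : 1 + -1 * slope n (k n) = 2 * (k n)%:R / sites n :> R.
    by rewrite slopeE -[n.+1%:R]/(sites n); ring.
  by field; rewrite !gt_eqF.
have stNk : stirling_log (n.+1 - k n) @[n --> \oo] --> l.
  apply: (st _ _ _ _ (two_pm 1)); apply: (filterS _ kn) => n /andP[k0 kN].
  have jR : 0 < (n.+1 - k n)%:R :> R by rewrite ltr0n subn_gt0.
  have NR : 0 < sites n :> R := sites_gt0 n.
  split; first by rewrite subn_gt0.
  have -> : 1 + 1 * slope n (k n) = 2 * (n.+1 - k n)%:R / sites n :> R.
    rewrite slopeE -[n.+1%:R]/(sites n) natrB 1?ltnW// -[n.+1%:R]/(sites n).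
    by field; rewrite gt_eqF.
  by field; rewrite !gt_eqF.
have lns : ln (1 - slope n (k n) ^+ 2) @[n --> \oo] --> (0 : R).
  have h : 1 - slope n (k n) ^+ 2 @[n --> \oo] --> (1 : R).
    rewrite [X in _ --> X](_ : 1 = 1 - 0 ^+ 2); last by rewrite expr0n subr0.
    by apply: cvgB; [exact: cvg_cst|exact: cvg_exprn].
  rewrite -[X in _ --> X](@ln1 R).
  exact: (continuous_cvg _ (continuous_ln ltr01) h).
have rem : sites n * coin_remainder (slope n (k n)) @[n --> \oo] --> (0 : R).
  apply: (@squeeze_cvgr _ _ _ _ (fun=> 0)
    (fun n => 64 * grid_point n (k n) ^+ 6 * slope n (k n) ^+ 2 / 28)).
  - near=> n.
    have sn : `|slope n (k n) : R| < 1 / 2.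
      by near: n; apply: (cvgr_norm_lt _ s0); rewrite normr0.
    rewrite mulr_ge0 ?(ltW (sites_gt0 _)) ?coin_remainder_ge0//=; last by lra.
    have -> : 64 * grid_point n (k n) ^+ 6 * slope n (k n) ^+ 2 / 28
        = sites n * (slope n (k n) ^+ 8 / 28) :> R.
      by rewrite -root6X {2}/slope /slope; field; rewrite gt_eqF.
    by rewrite ler_pM2l ?sites_gt0// coin_remainder_le// ltW.
  - exact: cvg_cst.
  - rewrite [X in _ --> X](_ : 0 = 64 * x ^+ 6 * 0 ^+ 2 / 28); last first.
      by rewrite expr0n mulr0 mul0r.
    apply: cvgM; last exact: cvg_cst.
    by apply: cvgM; [apply: cvgM; [exact: cvg_cst|]|]; exact: cvg_exprn.
(* As [root6 n * slope] is twice the grid point, only one factor [slope] is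
   left over; this is why the perturbation of [beta] disappears. *)
have quad : root6 n * b * (6 * slope n (k n) ^+ 2 + slope n (k n) ^+ 4) / 8
    @[n --> \oo] --> (0 : R).
  have -> : (fun n => root6 n * b * (6 * slope n (k n) ^+ 2 + slope n (k n) ^+ 4) / 8)
    = fun n => b / 4 * grid_point n (k n) * (6 * slope n (k n) + slope n (k n) ^+ 3).
    apply/funext => n.
    have -> : grid_point n (k n) = root6 n * slope n (k n) / 2 :> R.
      by rewrite /slope; field; rewrite gt_eqF.
    by field.
  rewrite [X in _ --> X](_ : 0 = b / 4 * x * (6 * 0 + 0 ^+ 3)); last first.
    by rewrite expr0n mulr0 addr0 mulr0.
  apply: cvgM; first by apply: cvgM => //; exact: cvg_cst.
  by apply: cvgD; [apply: cvgM => //; exact: cvg_cst|exact: cvg_exprn].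
have logc : log_psi n (k n) @[n --> \oo] -->
    ln 2 + (l - l - l) - 0 / 2 - 32 / 15 * x ^+ 6 - 0 + 0 - hbar * x.
  apply: cvgB; last by apply: cvgM => //; exact: cvg_cst.
  apply: cvgD => //; apply: cvgB => //; apply: cvgB; last first.
    by apply: cvgM; [exact: cvg_cst|exact: cvg_exprn].
  apply: cvgB; last by apply: cvgM => //; exact: cvg_cst.
  by apply: cvgD; [exact: cvg_cst|apply: cvgB => //; exact: cvgB].
have -> : 2 * expR (- l) * limit_density x
    = expR (ln 2 + (l - l - l) - 0 / 2 - 32 / 15 * x ^+ 6 - 0 + 0 - hbar * x).
  rewrite /limit_density -[X in X * _ * _](@lnK R 2) ?posrE// -!expRD.
  by congr expR; ring.
apply: cvg_trans (continuous_cvg _ (@continuous_expR R _) logc).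
by apply: near_eq_cvg; apply: (filterS _ kn) => n /psiE ->.
Unshelve. all: by end_near. Qed.

End limits.

(** * Convergence of the weighted sums *)

Section riemann.
Context {R : realType} (b hbar l : R).
Hypothesis hl : forall n, (0 < n)%N ->
  l <= stirling_log n <= l + n%:R^-1 / 4.
Local Notation mu := (@lebesgue_measure R).
Local Notation psi := (psi b hbar).
Local Notation limit_density := (limit_density hbar).

Lemma mem_cell n k (x : R) :
  cell (fun n => sites n / 2) mesh n k x =
  (grid_point n k.+1 < x <= grid_point n k) :> Prop.
Proof. by rewrite /cell /= in_itv. Qed.

(** The index of the cell containing [x]; it is interior as soon as the range
    of the grid, of half-length [root6 n / 2], exceeds [|x| + 1]. *)
Lemma grid_index (x : R) : exists k : nat -> nat,
  [/\ \forall n \near \oo, (0 < k n < n.+1)%N,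
      \forall n \near \oo, cell (fun n => sites n / 2) mesh n (k n) x &
      grid_point n (k n) @[n --> \oo] --> x].
Proof.
pose u n : R := sites n / 2 - root6 n ^+ 5 * x.
have big : \forall n \near \oo, 2 * `|x| + 2 <= root6 n.
  by move/cvgryPge: (@root6_cvg R); exact.
have u_itv : \forall n \near \oo, 1 <= u n /\ u n < n.+1%:R.
  apply: (filterS _ big) => n rn.
  have r5 : 1 <= root6 n ^+ 5 :> R by rewrite exprn_ege1// root6_ge1.
  have uE : u n = root6 n ^+ 5 * (root6 n / 2 - x).
    by rewrite /u -root6X; ring.
  have NE : n.+1%:R = root6 n ^+ 5 * root6 n :> R by rewrite -exprSr root6X.
  have x1 : x <= `|x| by exact: ler_norm.
  have x2 : - x <= `|x| by rewrite -normrN ler_norm.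
  split.
    by rewrite uE mulr_ege1//; lra.
  by rewrite uE NE ltr_pM2l ?(lt_le_trans ltr01)//; lra.
have k_itv : \forall n \near \oo,
    (0 < Num.truncn (u n) < n.+1)%N /\
    (Num.truncn (u n))%:R <= u n < (Num.truncn (u n)).+1%:R.
  apply: (filterS _ u_itv) => n [u1 uN].
  have u0 : 0 <= u n by lra.
  have := truncn_itv u0 => kI; split=> //; move/andP: kI => [k1 k2].
  apply/andP; split.
    by rewrite -ltnS -(ltr_nat R); exact: le_lt_trans u1 k2.
  by rewrite -(ltr_nat R); exact: le_lt_trans k1 uN.
have k_cell : \forall n \near \oo,
    grid_point n (Num.truncn (u n)).+1 < x <= grid_point n (Num.truncn (u n)).
  apply: (filterS _ k_itv) => n [_ /andP[k1 k2]].
  have r5 : 0 < root6 n ^+ 5 :> R by rewrite exprn_gt0// root6_gt0.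
  rewrite /grid_point /mesh ltr_pdivrMr// ler_pdivlMr//.
  move: k1 k2; rewrite /u [root6 n ^+ 5 * x]mulrC.
  by move: (x * _) (Num.truncn _) => z j; lra.
exists (fun n => Num.truncn (u n)); split.
- by apply: (filterS _ k_itv) => n [].
- by apply: (filterS _ k_cell) => n; rewrite mem_cell.
apply: (@squeeze_cvgr _ _ _ _ (fun=> x) (fun n => x + mesh n)).
- apply: (filterS _ k_cell) => n /andP[k1 k2]; rewrite k2/=.
  by move: k1; rewrite /grid_point -[X in X%:R]addn1 natrD; lra.
- exact: cvg_cst.
- rewrite -[X in _ --> X]addr0; apply: cvgD; first exact: cvg_cst.
  exact: mesh_cvg0.
Qed.

(** The Gaussian bound of [psi_gauss] supplies the dominating function and
    [psi_cvg], along the indices of the cells of a fixed point, the pointwise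
    limit. *)
Lemma weighted_sum_cvg (G : R -> R) (B : R) :
  continuous G -> (forall x, `|G x| <= B) ->
  let f x := 2 * expR (- l) * limit_density x * G x in
  mu.-integrable setT (EFin \o f) /\
  mesh n * \sum_(k < n.+2) psi n k * G (grid_point n k) @[n --> \oo]
    --> (\int[mu]_x f x)%R.
Proof.
move=> Gc GB f.
have B0 : 0 <= B by exact: le_trans (GB 0).
have [C hC] := psi_gauss b hbar hl.
pose dom x : R := B * expR (C + 2) * gauss_fun x.
have f_cont : continuous f.
  have dens : continuous limit_density.
    have -> : limit_density = expR \o (fun t => - (32 / 15) * t ^+ 6 - hbar * t).
      by [].
    move=> x; apply: continuous_comp; last exact: continuous_expR.
    apply: cvgB; apply: cvgM; try exact: cvg_cst; last exact: cvg_id.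
    exact: exprn_continuous.
  move=> x; apply: (@cvgM _ _ _ _ (fun t => 2 * expR (- l) * limit_density t) G).
    by apply: cvgM; [exact: cvg_cst|exact: dens].
  exact: Gc.
apply: (@riemann_sum_cvg R (fun n => n.+2) (fun n => sites n / 2) mesh
  (fun n k => psi n k * G (grid_point n k)) _ f dom).
- by move=> n; exact: mesh_gt0.
- have := @integrableZl _ _ _ mu setT measurableT (B * expR (C + 2)) _ integrableT_gauss.
  by under eq_fun do rewrite /= -EFinM.
- exact: continuous_measurable_fun.
- by move=> x; rewrite mulr_ge0 ?gauss_fun_ge0// mulr_ge0// expR_ge0.
(* A cell has width at most 1, and [x ^ 2 <= 2 y ^ 2 + 2] when [|y - x| <= 1]. *)
- move=> n k x kn; rewrite mem_cell => /andP[x1 x2].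
  rewrite normrM gtr0_norm ?psi_gt0// mulrC.
  rewrite /dom -mulrA ler_pM// ?(ltW (psi_gt0 _ _ _))//.
  apply: le_trans (hC _ _ _) _ => //.
  rewrite /gauss_fun -expRD ler_expR.
  have xm : grid_point n k < x + 1.
    have : mesh n <= 1 :> R by exact: mesh_le1.
    move: x1.
    by rewrite /grid_point -[X in X%:R]addn1 natrD; lra.
  move: (grid_point n k) x2 xm => y xy yx.
  have th : (y - x) ^+ 2 <= 1 by rewrite expr_le1//; lra.
  by have := sqr_ge0 (x + 2 * (y - x)); lra.
move=> x; have [k [kn kx yx]] := grid_index x.
have h : psi n (k n) * G (grid_point n (k n)) @[n --> \oo] --> f x.
  by apply: cvgM; [exact: psi_cvg|exact: (cvg_comp _ _ yx (Gc x))].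
apply: cvg_trans h; apply: near_eq_cvg.
near=> n; symmetry.
have kx' : cell (fun n => sites n / 2) mesh n (k n) x by near: n.
apply: (step_funE _ _ _ kx'); first by move=> m; exact: mesh_gt0.
have /andP[_ kN] : (0 < k n < n.+1)%N by near: n.
exact: ltnW.
Unshelve. all: by end_near. Qed.

End riemann.

(** * The limit theorem *)

Section scaled_configurations.
Context {R : realType} (hq : (1 < 2)%N) (b hbar : R).
Local Notation c1 := (color1 hq).
Local Notation psi := (psi b hbar).

Lemma scaled_empirical n (x : {ffun 'I_n.+1 -> 'I_2}) :
  n.+1%:R `^ (1 / 6) *: (empirical x - potts_x hq 0)
  = grid_point n (count1 hq x) *: potts_u R hq.
Proof.
have [e1 e2] := @empirical_two_colors R hq _ x isT.
have r0 : root6 n != 0 :> R by rewrite gt_eqF// root6_gt0.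
have xE : grid_point n (count1 hq x)
    = root6 n / 2 * (1 - 2 * ((count1 hq x)%:R / n.+1%:R)) :> R.
  by rewrite mulrA -slopeE /slope; field.
apply/colP => r; rewrite xE -[n.+1%:R `^ _]/(root6 n).
have sub2 (A B : 'cV[R]_2) i : (A - B) i 0 = A i 0 - B i 0 by rewrite !mxE.
rewrite [LHS]mxE sub2 [RHS]mxE [potts_x _ _ _ _]mxE [potts_u _ _ _ _]mxE.
case: (color_cases hq r) => ->.
  by rewrite eqxx e1; move: (_ / n.+1%:R) => t; field.
by rewrite e2 (negbTE (color1_ord_max hq)); move: (_ / n.+1%:R) => t; field.
Qed.

Lemma potts_weight_two n (x : config hq n.+1) :
  potts_weight 4 (2 / 3 + n.+1%:R `^ (- (5 / 6)) * b)
    (0 + n.+1%:R `^ (- (5 / 6)) * hbar) x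
  = expR (tilt_const b hbar n + tilt b hbar n (count1 hq x)).
Proof.
have [e1 e2] := @empirical_two_colors R hq _ x isT.
rewrite /potts_weight -tiltE (bigD1 c1)//= (bigD1 ord_max)//= big_pred0; last first.
  by move=> r; case: (color_cases hq r) => ->; rewrite ?eqxx ?andbF.
by rewrite e1 e2 addr0 add0r -[n.+1%:R `^ _]/(sites n `^ _) sites_powN56.
Qed.

(** The powers of 2 and of [N] and the constant part of the exponent cancel
    between the numerator and the partition function. *)
Lemma expectation_two_colors n d (T : measurableType d) (P : probability T R)
    (X : {RV P >-> config hq n.+1}) (G : R -> R) :
  (forall A : set (config hq n.+1), distribution P X A =
    potts 4 (2 / 3 + n.+1%:R `^ (- (5 / 6)) * b)
      (0 + n.+1%:R `^ (- (5 / 6)) * hbar) A) ->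
  ('E_P[(fun x => G (grid_point n (count1 hq x))) \o X] =
   ((mesh n * \sum_(k < n.+2) psi n k * G (grid_point n k)) /
    (mesh n * \sum_(k < n.+2) psi n k * 1))%R%:E)%E.
Proof.
move=> /expectation_potts ->; congr EFin.
pose K : R := root6 n ^+ 3 / 2 ^+ n.+1 / expR (tilt_const b hbar n).
have K0 : K != 0.
  rewrite gt_eqF// divr_gt0 ?expR_gt0// divr_gt0 ?exprn_gt0//.
  exact: root6_gt0.
have sumE (H : R -> R) : \sum_(x : config hq n.+1) H (grid_point n (count1 hq x)) *
    potts_weight 4 (2 / 3 + n.+1%:R `^ (- (5 / 6)) * b)
      (0 + n.+1%:R `^ (- (5 / 6)) * hbar) x
    = K^-1 * \sum_(k < n.+2) psi n k * H (grid_point n k).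
  under eq_bigr do rewrite potts_weight_two.
  rewrite (@sum_config R hq n.+1 (fun k => H (grid_point n k) *
    expR (tilt_const b hbar n + tilt b hbar n k))) mulr_sumr.
  apply: eq_bigr => k _; rewrite expRD /psi /K.
  have r0 : root6 n != 0 :> R by rewrite gt_eqF// root6_gt0.
  have e0 : expR (tilt_const b hbar n) != 0 by rewrite gt_eqF// expR_gt0.
  have t0 : 2 ^+ n.+1 != 0 :> R by rewrite expf_neq0.
  by field; rewrite ?r0 ?e0 ?t0.
rewrite sumE.
have -> : potts_partition hq 4 (2 / 3 + n.+1%:R `^ (- (5 / 6)) * b)
      (0 + n.+1%:R `^ (- (5 / 6)) * hbar) n.+1
    = K^-1 * \sum_(k < n.+2) psi n k * 1.
  by rewrite -(sumE (fun=> 1)); apply: eq_bigr => x _; rewrite mul1r.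
have m0 : mesh n != 0 :> R by rewrite gt_eqF// mesh_gt0.
by rewrite -[LHS]mulf_div -[RHS]mulf_div !divff// invr_eq0.
Qed.

End scaled_configurations.

Theorem theorem2p7 (R : realType) (p q : nat)
    (hp : (1 < p)%N) (hq : (1 < q)%N)
    (beta h : R) (hbeta : 0 < beta) (hh : 0 <= h)
    (hspecial : type2_special hq p beta h)
    (m : 'cV[R]_q) (hm : unique_global_maximizer hq p beta h m)
    (bbar hbar : R)
    (d : nat -> measure_display) (T : forall N, measurableType (d N))
    (P : forall N, probability (T N) R)
    (X : forall N, {RV (P N) >-> config hq N})
    (hX : forall N, (1 <= N)%N -> forall A : set (config hq N),
      distribution (P N) (X N) A =
      potts p (beta + N%:R `^ (- (5 / 6)) * bbar)
              (h + N%:R `^ (- (5 / 6)) * hbar) A)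
    (d' : measure_display) (T' : measurableType d') (P' : probability T' R)
    (F : {RV P' >-> R})
    (hF : has_density_proportional_to F
      (fun x => expR (- (32 / 15) * x ^+ 6 - hbar * x))) :
  cvg_in_distribution
    P (fun N w => N%:R `^ (1 / 6) *: (empirical (X N w) - m))
    P' (fun w => F w *: potts_u R hq).
Proof.
have [p4 q2 b23 h0 mE] := type2_special_point hp hbeta hh hspecial hm.
subst p q h beta m; clear hspecial hm hp hbeta hh.
move=> g gc [B gB].
pose G (x : R) := g (x *: potts_u R hq).
have Gc : continuous G.
  move=> x; apply: (continuous_comp (f := fun y : R => y *: potts_u R hq)).
    exact: scalel_continuous.
  exact: gc.
have GB x : `|G x| <= B by exact: gB.
have [l hl] := @stirling_log_limit R.
case: hF => c c0 hF.
pose K := 2 * expR (- l).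
have K0 : 0 < K by rewrite mulr_gt0// expR_gt0.
have one_c : continuous ((fun=> 1) : R -> R) by move=> x; exact: cvg_cst.
have [iG cvgG] := weighted_sum_cvg bbar hbar hl Gc GB.
have [i1 cvg1] := @weighted_sum_cvg R bbar hbar l hl (fun=> 1) 1 one_c
  (fun=> ltac:(by rewrite normr1)).
have w_int : (lebesgue_measure : {measure set (measurableTypeR R) -> \bar R}).-integrable
    setT (EFin \o (fun x => c * limit_density hbar x)).
  have := @integrableZl _ _ _ _ setT measurableT (c / K) _ i1.
  apply: eq_integrable => // x _ /=; rewrite -EFinM; congr EFin.
  by rewrite mulr1 -/K; field; rewrite gt_eqF.
have EG := expectation_density w_int hF
  (continuous_measurable_fun Gc : measurable_fun setT G) GB.
have density_int (H : R -> R) :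
    lebesgue_measure.-integrable setT
      (EFin \o (fun x => 2 * expR (- l) * limit_density hbar x * H x)) ->
    (\int[lebesgue_measure]_x (H x * (c * limit_density hbar x))%:E
     = ((c / K) * \int[lebesgue_measure]_x
          (2 * expR (- l) * limit_density hbar x * H x))%R%:E)%E.
  move=> iH; rewrite EFinM fineK ?integrable_fin_num// -integralZl//.
  apply: eq_integral => x _ /=; rewrite -EFinM -/K; congr EFin.
  by field; rewrite gt_eqF.
have I1 : (c / K) * (\int[lebesgue_measure]_x
    (2 * expR (- l) * limit_density hbar x * 1))%R = 1.
  apply: EFin_inj; rewrite -(density_int (fun=> 1))//.
  transitivity (distribution P' F setT); last exact: probability_setT.
  rewrite (hF setT measurableT).
  by apply: eq_integral => x _; rewrite mul1r.
have E' : ('E_P'[g \o (fun w => F w *: potts_u R hq)]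
    = ((c / K) * \int[lebesgue_measure]_x
          (2 * expR (- l) * limit_density hbar x * G x))%R%:E)%E.
  by rewrite -density_int// -EG.
rewrite E' -cvg_shiftS.
have EN n : ('E_(P n.+1)[g \o (fun w => n.+1%:R `^ (1 / 6)
      *: (empirical (X n.+1 w) - potts_x hq 0))]
    = ((mesh n * \sum_(k < n.+2) psi bbar hbar n k * G (grid_point n k)) /
       (mesh n * \sum_(k < n.+2) psi bbar hbar n k * 1))%R%:E)%E.
  rewrite -(expectation_two_colors _ (hX n.+1 isT)); congr ('E_(_)[_])%E.
  by apply/funext => w /=; rewrite scaled_empirical.
under eq_fun do rewrite EN.
apply: cvg_EFin; first exact: nearW.
(* The density has total mass 1, which determines the limit of the scaled
   partition functions. *)
have e0 : (\int[lebesgue_measure]_x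
    (2 * expR (- l) * limit_density hbar x * 1))%R = K / c.
  have cK : c / K != 0 by rewrite gt_eqF// divr_gt0.
  by apply: (mulfI cK); rewrite I1; field; rewrite !gt_eqF.
rewrite e0 in cvg1.
rewrite [X in _ --> X](_ : _ = (\int[lebesgue_measure]_x
    (2 * expR (- l) * limit_density hbar x * G x))%R / (K / c)); last first.
  by field; rewrite !gt_eqF.
apply: cvgM; first exact: cvgG.
by apply: cvgV; [rewrite gt_eqF// divr_gt0|exact: cvg1].
Qed.
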